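(* Let $K$ be a field, $n\ge2$, $R=K[x_{ij}:1\le i\le j\le n]$, $G$ an undirected simple graph on $[n]$, and $T\subseteq G$ a spanning forest of $G$. Then the $(n-1)$-minors of $X_G$ form a Gröbner basis of $I_{n-1}(X_G)$ with respect to $<_{T,G}$ with square-free initial ideal $I_T|_{Z=0}\subseteq R$. In particular, $I_{n-1}(X_G)$ is always radical and $$\operatorname{ht}(I_{n-1}(X_G))=\begin{cases}3&\text{if }G\text{ is connected},\\2&\text{otherwise}.\end{cases}$$
   Context: $[n]=\{1,\dots,n\}$; $X=(x_{ij})$ is the generic symmetric $n\times n$ matrix with $x_{ij}:=x_{ji}$ for $i>j$. $Z$ is the set of off-diagonal variables $x_{ij}$ ($i<j$) with $ij$ not an edge of $G$. $X_G$ is obtained from $X$ by substituting $0$ for all variables in $Z$; $I_{n-1}(X_G)$ is the ideal of $R$ generated by all $(n-1)$-minors of $X_G$, i.e. by $\det((X_G)_{[n]\setminus k,[n]\setminus l})$, $1\le k\le l\le n$ (zero minors are disregarded in a Gröbner basis). A spanning forest $T\subseteq G$ is the union of one spanning tree for each connected component of $G$. Weights and orders. For a graph $H$ on $[n]$, $w_H$ is the weight vector with $w_H(x_{ii})=2$ for all $i$, $w_H(x_{ij})=2$ for edges $ij\in H$, and $w_H(x_{ij})=1$ for $i<j$, $ij\notin H$. $w_{\mathrm{diag}}$ is $w_H$ for $H$ without edges. The (partial) weight order $<_{T,G}$ compares two monomials first by $w_G$-degree, then, if these are equal, by $w_T$-degree, and then, if these are equal as well, by $w_{\mathrm{diag}}$-degree.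 For $0\ne f\in R$, $\operatorname{in}_{<_{T,G}}(f)$ is the sum of all terms of $f$ whose monomials are maximal for this comparison; the initial ideal of $J$ is the ideal generated by the initial forms of all nonzero elements of $J$; elements of $J$ form a Gröbner basis if their initial forms generate the initial ideal of $J$. Ideal $I_T|_{Z=0}$. Paths have no repeated vertices and contain at least one edge; for a path $p$, $V(p)$ is its vertex set and $x_p:=\prod_{ij\in p}x_{ij}$ is the product over its edges. $I_T\subseteq R$ is generated by the monomials - $\frac{x_{11}\cdots x_{nn}}{x_{ii}}$ for all $i=1,\dots,n$; - $\frac{x_{11}\cdots x_{nn}}{x_{kk}x_{ll}}x_{kl}$ for all $1\le k<l\le n$ such that there is no path in $T$ between $k$ and $l$; - $\left(\prod_{i\in[n]\setminus V(p)}x_{ii}\right)\cdot x_p$ for all paths $p$ in $T$. $I_T|_{Z=0}$ is the ideal of $R$ generated by the images of elements of $I_T$ under substituting $0$ for all variables in $Z$. *)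

(* Defs.v *)
From mathcomp Require Import all_boot all_order all_algebra.
From mathcomp Require Import boolp classical_sets.
From mathcomp Require Import mpoly ring_quotient.

Set Implicit Arguments.
Unset Strict Implicit.
Unset Printing Implicit Defensive.

Import GRing.Theory.

Local Open Scope ring_scope.
Local Open Scope classical_set_scope.

Definition ideal_gen (R : comNzRingType) (S : set R) : set R :=
  [set f | exists2 s : seq (R * R),
     (forall ab, ab \in s -> S ab.2) & f = \sum_(ab <- s) ab.1 * ab.2].

Definition radical_ideal (R : comNzRingType) (J : set R) : Prop :=
  forall (f : R) (k : nat), J (f ^+ k) -> J f.

(* Properness is part of the library's [idealr_closed]. *)
Definition prime_ideal (R : comNzRingType) (P : set R) : Prop :=
  idealr_closed (mem P) /\ prime_idealr_closed (mem P).

Definition prime_chain_to (R : comNzRingType) (P : set R) (h : nat) : Prop :=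
  exists Q : nat -> set R,
    [/\ forall i, (i <= h)%N -> prime_ideal (Q i),
        forall i, (i < h)%N -> Q i `<` Q i.+1
      & Q h = P].

(* ht P = h: the supremum of the lengths of chains of primes ending at P. *)
Definition prime_height (R : comNzRingType) (P : set R) (h : nat) : Prop :=
  prime_chain_to P h /\ forall m, prime_chain_to P m -> (m <= h)%N.

(* ht J = h: the minimum of the heights of the primes containing J. The second
   conjunct says that every such prime has (possibly infinite) height >= h. *)
Definition ideal_height (R : comNzRingType) (J : set R) (h : nat) : Prop :=
  (exists P, [/\ prime_ideal P, J `<=` P & prime_height P h]) /\
  (forall P, prime_ideal P -> J `<=` P -> prime_chain_to P h).

Definition simple_graph (n : nat) (e : rel 'I_n) : Prop :=
  ssrbool.symmetric e /\ irreflexive e.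

Definition no_edges (n : nat) : rel 'I_n := fun _ _ => false.

Definition components (n : nat) (e : rel 'I_n) : {set {set 'I_n}} :=
  [set [set y | connect e x y]%SET | x : 'I_n]%SET.

Definition connected_graph (n : nat) (e : rel 'I_n) : bool :=
  [forall x, forall y, connect e x y].

Definition acyclic (n : nat) (e : rel 'I_n) : Prop :=
  forall c : seq 'I_n, (2 < size c)%N -> ~ ucycle e c.

(* [t] is a spanning tree of the subgraph of [e] induced on [C]. *)
Definition spanning_tree (n : nat) (e : rel 'I_n) (C : {set 'I_n})
    (t : rel 'I_n) : Prop :=
  [/\ simple_graph t,
      forall x y, t x y -> [/\ x \in C, y \in C & e x y],
      {in C &, forall x y, connect t x y}
    & acyclic t].

Definition spanning_forest (n : nat) (e f : rel 'I_n) : Prop :=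
  exists t : {set 'I_n} -> rel 'I_n,
    (forall C, C \in components e -> spanning_tree e C (t C)) /\
    (forall x y, f x y = [exists C in components e, t C x y]).

(* The path x, p_1, ..., p_k, with no repeated vertex and at least one edge. *)
Definition simple_path (n : nat) (e : rel 'I_n) (x : 'I_n) (p : seq 'I_n) :
    bool :=
  [&& p != [::], path e x p & uniq (x :: p)].

Definition symvar (n : nat) : predArgType :=
  {ij : 'I_n * 'I_n | (ij.1 <= ij.2)%N}.

(* Variable [v : 'I_(nvars n)] is x_ij for
   (i, j) = val (enum_val v). *)
Definition nvars (n : nat) : nat := #|symvar n|.

Definition sort_pair (n : nat) (i j : 'I_n) : 'I_n * 'I_n :=
  if (i <= j)%N then (i, j) else (j, i).

Lemma sort_pairP (n : nat) (i j : 'I_n) :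
  ((sort_pair i j).1 <= (sort_pair i j).2)%N.
Proof. by rewrite /sort_pair; case: (leqP i j) => [|/ltnW]. Qed.

Definition var_idx (n : nat) (i j : 'I_n) : 'I_(nvars n) :=
  enum_rank (exist _ (sort_pair i j) (sort_pairP i j) : symvar n).

(* x_ij, with the convention x_ij = x_ji for i > j. *)
Definition x_ (K : fieldType) (n : nat) (i j : 'I_n) : {mpoly K[nvars n]} :=
  'X_(var_idx i j).

Definition symX (K : fieldType) (n : nat) : 'M[{mpoly K[nvars n]}]_n :=
  \matrix_(i, j) x_ K i j.

Definition var_fst (n : nat) (v : 'I_(nvars n)) : 'I_n :=
  (sval (enum_val v)).1.
Definition var_snd (n : nat) (v : 'I_(nvars n)) : 'I_n :=
  (sval (enum_val v)).2.

Definition in_Z (n : nat) (G : rel 'I_n) (v : 'I_(nvars n)) : bool :=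
  (var_fst v < var_snd v)%N && ~~ G (var_fst v) (var_snd v).

Definition subst_Z (K : fieldType) (n : nat) (G : rel 'I_n)
    (f : {mpoly K[nvars n]}) : {mpoly K[nvars n]} :=
  comp_mpoly [tuple (if in_Z G v then 0 else 'X_v) | v < nvars n] f.

Definition X_of (K : fieldType) (n : nat) (G : rel 'I_n) :
    'M[{mpoly K[nvars n]}]_n :=
  map_mx (subst_Z G) (symX K n).

Definition minors (K : fieldType) (n : nat) (G : rel 'I_n) :
    set {mpoly K[nvars n]} :=
  [set f | exists k l : 'I_n,
     (k <= l)%N /\ f = \det (row' k (col' l (X_of K G)))].
Arguments minors K {n} G.

Definition I_minors (K : fieldType) (n : nat) (G : rel 'I_n) :
    set {mpoly K[nvars n]} := ideal_gen (minors K G).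
Arguments I_minors K {n} G.

Definition weight (n : nat) (H : rel 'I_n) (v : 'I_(nvars n)) : nat :=
  if (var_fst v == var_snd v) || H (var_fst v) (var_snd v) then 2%N else 1%N.

Definition wdeg (n : nat) (H : rel 'I_n) (m : 'X_{1..nvars n}) : nat :=
  (\sum_(v < nvars n) m v * weight H v)%N.

Definition lt_TG (n : nat) (T G : rel 'I_n) (m m' : 'X_{1..nvars n}) : bool :=
  (wdeg G m < wdeg G m')%N ||
  (wdeg G m == wdeg G m') &&
    ((wdeg T m < wdeg T m')%N ||
     (wdeg T m == wdeg T m') &&
       (wdeg (@no_edges n) m < wdeg (@no_edges n) m')%N).

Definition init_form (K : fieldType) (N : nat) (lt : rel 'X_{1..N})
    (f : {mpoly K[N]}) : {mpoly K[N]} :=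
  \sum_(m <- msupp f | all (fun m' => ~~ lt m m') (msupp f))
    f@_m *: 'X_[m].

Definition init_ideal (K : fieldType) (N : nat) (lt : rel 'X_{1..N})
    (J : set {mpoly K[N]}) : set {mpoly K[N]} :=
  ideal_gen [set g | exists f, [/\ J f, f != 0 & g = init_form lt f]].

(* Zero elements of [S] are disregarded. *)
Definition groebner_basis (K : fieldType) (N : nat) (lt : rel 'X_{1..N})
    (S J : set {mpoly K[N]}) : Prop :=
  S `<=` J /\
  ideal_gen [set g | exists f, [/\ S f, f != 0 & g = init_form lt f]]
    = init_ideal lt J.

Definition squarefree_monomial_ideal (K : fieldType) (N : nat)
    (J : set {mpoly K[N]}) : Prop :=
  exists2 M : set 'X_{1..N},
    (forall m, M m -> forall v, (m v <= 1)%N) &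
    J = ideal_gen [set 'X_[m] | m in M].

Definition path_monomial (K : fieldType) (n : nat) (k : 'I_n) (p : seq 'I_n) :
    {mpoly K[nvars n]} :=
  \prod_(e <- zip (k :: p) p) x_ K e.1 e.2.

Inductive I_T_gens (K : fieldType) (n : nat) (T : rel 'I_n) :
    {mpoly K[nvars n]} -> Prop :=
| I_T_diag (i : 'I_n) : I_T_gens T (\prod_(j | j != i) x_ K j j)
| I_T_nopath (k l : 'I_n) :
    (k < l)%N -> ~ (exists p, simple_path T k p /\ last k p = l) ->
    I_T_gens T ((\prod_(j | (j != k) && (j != l)) x_ K j j) * x_ K k l)
| I_T_path (k : 'I_n) (p : seq 'I_n) :
    simple_path T k p ->
    I_T_gens T ((\prod_(i | i \notin k :: p) x_ K i i) * path_monomial K k p).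

Definition I_T (K : fieldType) (n : nat) (T : rel 'I_n) :
    set {mpoly K[nvars n]} := ideal_gen (I_T_gens (K := K) T).
Arguments I_T K {n} T.

Definition I_T_Z0 (K : fieldType) (n : nat) (G T : rel 'I_n) :
    set {mpoly K[nvars n]} := ideal_gen [set subst_Z G f | f in I_T K T].
Arguments I_T_Z0 K {n} G T.

(* Main.v *)
(* Let A be the adjugate of X_G. For k, l in one component of G, the unique
   T-path from k to l gives the only monomial of A_kl of maximal weight, with
   coefficient 1 or -1. The entries of X_G * A = det(X_G) * 1 say that, modulo
   terms of smaller weight, lengthening or shortening a path at one end changes
   A_kl by the corresponding monomial factors. Hence every monomial multiple of
   an A_kl can be moved, modulo smaller terms, to one whose path is as short as
   its leading monomial u permits; that path depends on u only. So I_{n-1}(X_G)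
   has a K-basis with pairwise distinct leading monomials, namely the monomials
   of I_T|_{Z=0}. The initial ideal can be read off, and it is square-free, so
   normal forms show that I_{n-1}(X_G) is radical.

   For the height h: the monomials outside the initial ideal involve at most
   N - h of the N variables, so, counting monomials, at most N - h variables are
   independent modulo a prime P containing I_{n-1}(X_G); contracting P to the
   first i variables and extending back, for i = 0, ..., N, gives a chain of
   length at least h. Conversely some h variables (x_aa, x_bb, x_ab for an edge
   ab of T, or x_aa, x_bb for a, b in different components) meet every generator
   of the initial ideal, so some prime P keeps the other N - h variables
   independent, and a chain of length m below P yields N - h + m algebraically
   independent polynomials, whence m <= h. *)

From HB Require Import structures.
Require Import Defs.
From mathcomp Require Import all_boot all_order all_algebra perm.
From mathcomp Require Import boolp classical_sets.
From mathcomp Require Import mpoly ring_quotient zify.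

Set Implicit Arguments.
Unset Strict Implicit.
Unset Printing Implicit Defensive.

Import GRing.Theory.

(** * Ideals and standard monomials *)

Section Ideals.
Local Open Scope ring_scope.
Variable R : comNzRingType.
Implicit Types (S : set R) (f g a : R).

Lemma ideal_gen_sub S f : S f -> ideal_gen S f.
Proof.
move=> Sf; exists [:: (1, f)]; last by rewrite big_seq1 mul1r.
by move=> ab; rewrite inE => /eqP ->.
Qed.

Lemma ideal_gen0 S : ideal_gen S 0.
Proof. by exists [::]; rewrite ?big_nil. Qed.

Lemma ideal_genD S f g : ideal_gen S f -> ideal_gen S g -> ideal_gen S (f + g).
Proof.
move=> [s Ps ->] [t Pt ->]; exists (s ++ t); last by rewrite big_cat.
by move=> ab; rewrite mem_cat => /orP[/Ps|/Pt].
Qed.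

Lemma ideal_genM S a f : ideal_gen S f -> ideal_gen S (a * f).
Proof.
move=> [s Ps ->]; exists [seq (a * ab.1, ab.2) | ab <- s].
  by move=> _ /mapP[ab abs ->]; apply: Ps abs.
by rewrite big_map mulr_sumr; apply: eq_bigr => ab _; rewrite mulrA.
Qed.

Lemma ideal_genMr S a f : ideal_gen S f -> ideal_gen S (f * a).
Proof. by rewrite mulrC; apply: ideal_genM. Qed.

Lemma ideal_genN S f : ideal_gen S f -> ideal_gen S (- f).
Proof. by rewrite -mulN1r; apply: ideal_genM. Qed.

Lemma ideal_genB S f g : ideal_gen S f -> ideal_gen S g -> ideal_gen S (f - g).
Proof. by move=> Sf Sg; apply: ideal_genD Sf (ideal_genN Sg). Qed.

Lemma ideal_gen_sum S (I : eqType) (r : seq I) (P : pred I) (F : I -> R) :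
  (forall i, i \in r -> P i -> ideal_gen S (F i)) ->
  ideal_gen S (\sum_(i <- r | P i) F i).
Proof.
move=> SF; rewrite big_seq_cond.
by elim/big_ind: _ => [||i /andP[]]; [exact: ideal_gen0|exact: ideal_genD|exact: SF].
Qed.

Lemma ideal_gen_min S S' :
  (forall f, S f -> ideal_gen S' f) -> (ideal_gen S `<=` ideal_gen S')%classic.
Proof.
by move=> SS' _ [s Ps ->]; apply: ideal_gen_sum => ab /Ps /SS' /ideal_genM.
Qed.

End Ideals.

Section LinearIdeals.
Local Open Scope ring_scope.
Variables (K : fieldType) (N : nat) (S : set {mpoly K[N]}).
Implicit Types f g : {mpoly K[N]}.

Lemma ideal_genZ c f : ideal_gen S f -> ideal_gen S (c *: f).
Proof. by rewrite -mul_mpolyC; apply: ideal_genM. Qed.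

Lemma ideal_gen_exp f g k :
  ideal_gen S (f - g) -> ideal_gen S (f ^+ k) -> ideal_gen S (g ^+ k).
Proof.
move=> Sfg Sf; rewrite -[g ^+ k](subKr (f ^+ k)) subrXX.
by apply: ideal_genB Sf _; apply: ideal_genMr.
Qed.

End LinearIdeals.

(* [B u] plays the role of an element of [J] with leading monomial [u]; the
   order [lt] is only a strict weak order, as weight orders are. *)
Section StandardMonomials.
Local Open Scope ring_scope.
Variables (K : fieldType) (N : nat) (lt : rel 'X_{1..N}).
Hypothesis lt_irr : irreflexive lt.
Hypothesis lt_trans : transitive lt.
Hypothesis lt_weak : forall a b c, lt a c -> lt a b || lt b c.
Hypothesis lt_add2r : forall a b c, lt (a + c)%MM (b + c)%MM = lt a b.
Hypothesis lt_ind : forall P : 'X_{1..N} -> Prop,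
  (forall u, (forall t, lt t u -> P t) -> P u) -> forall u, P u.

Variable S : set {mpoly K[N]}.
Let J := ideal_gen S.
Variables (M : pred 'X_{1..N}) (B : 'X_{1..N} -> {mpoly K[N]}).
Hypothesis B_ideal : forall u, M u -> J (B u).
Hypothesis B_lead : forall u, M u -> (B u)@_u = 1.
Hypothesis B_low : forall u m, M u -> m \in msupp (B u) -> m != u ->
  lt m u /\ mdeg m = mdeg u.
Hypothesis B_span : forall f, J f -> exists2 s : seq (K * 'X_{1..N}),
  (forall cu, cu \in s -> M cu.2) & f = \sum_(cu <- s) cu.1 *: B cu.2.

Lemma weak_order_max (U : seq 'X_{1..N}) : U != [::] ->
  exists2 u, u \in U & forall v, v \in U -> ~~ lt u v.
Proof.
elim: U => // a U IH _; case: (eqVneq U [::]) => [->|/IH[u uU umax]].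
  by exists a; rewrite ?mem_head // => v; rewrite inE => /eqP ->; rewrite lt_irr.
case: (boolP (lt u a)) => [ua|nua].
  exists a; first exact: mem_head.
  move=> v; rewrite inE => /orP[/eqP ->|vU]; first by rewrite lt_irr.
  by apply: contra (umax v vU) => /(lt_trans ua).
exists u; first by rewrite inE uU orbT.
by move=> v; rewrite inE => /orP[/eqP ->|/umax].
Qed.

(** With distinct indices and nonzero coefficients, the leading monomial of a maximal index cannot
    cancel in the sum. *)
Lemma span_collect f : J f -> exists U : seq 'X_{1..N}, exists c : 'X_{1..N} -> K,
  [/\ uniq U, forall u, u \in U -> M u /\ c u != 0
    & f = \sum_(u <- U) c u *: B u].
Proof.
case/B_span=> s sM ->; set c := fun u => \sum_(cu <- s | cu.2 == u) cu.1.
set U := undup [seq cu.2 | cu <- s].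
have UM u : u \in U -> M u by rewrite mem_undup => /mapP[cu /sM ? ->].
exists [seq u <- U | c u != 0], c; split.
- by rewrite filter_uniq ?undup_uniq.
- by move=> u; rewrite mem_filter => /andP[? /UM].
rewrite big_filter [RHS]big_mkcond /=.
transitivity (\sum_(u <- U) c u *: B u); last first.
  by apply: eq_bigr => u _; case: eqP => //= ->; rewrite scale0r.
transitivity (\sum_(u <- U) \sum_(cu <- s | cu.2 == u) cu.1 *: B cu.2); last first.
  by apply: eq_bigr => u _; rewrite scaler_suml; apply: eq_bigr => cu /eqP ->.
rewrite (exchange_big_dep predT) //= big_seq [RHS]big_seq.
apply: eq_bigr => cu cus.
rewrite (eq_bigl (pred1 cu.2)) => [|u]; last by rewrite /= eq_sym.
have cuU : cu.2 \in U by rewrite mem_undup; apply: map_f.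
by rewrite -big_filter filter_pred1_uniq ?undup_uniq // big_seq1.
Qed.

(** If a maximal monomial m of f were outside [M], it would lie strictly below the index u of some
    [B u] in the expansion. A maximal index w is itself a monomial of f, and m < u forces m < w or w
    < u because the order is weak; both contradict maximality. *)
Lemma top_monomial f m : J f -> m \in msupp f ->
  (forall m', m' \in msupp f -> ~~ lt m m') -> M m.
Proof.
move=> /span_collect[U [c [Uu UM fE]]] mf mmax; apply/negPn/negP => mM.
have [u uU mu] : exists2 u, u \in U & m \in msupp (B u).
  move: mf; rewrite mcoeff_msupp fE raddf_sum /= => nz.
  have /hasP[u uU mu] : has (fun u => m \in msupp (B u)) U.
    apply: contraR nz => /hasPn nU; rewrite big_seq big1 // => u uU.
    by rewrite mcoeffZ (memN_msupp_eq0 (nU u uU)) mulr0.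
  by exists u.
have mltu : lt m u.
  have [Mu _] := UM u uU; apply: (B_low Mu mu _).1.
  by apply: contraNneq mM => ->.
have [w wU wmax] : exists2 w, w \in U & forall v, v \in U -> ~~ lt w v.
  by apply: weak_order_max; case: (U) uU.
have wf : w \in msupp f.
  rewrite mcoeff_msupp fE raddf_sum /= (bigD1_seq w) //= mcoeffZ.
  have [Mw cw] := UM w wU; rewrite B_lead // mulr1 big1_seq ?addr0 // => v.
  move=> /andP[vw vU]; rewrite mcoeffZ memN_msupp_eq0 ?mulr0 //.
  apply/negP => wv; have := (B_low (UM v vU).1 wv); rewrite eq_sym => /(_ vw)[wltv _].
  by move: (wmax v vU); rewrite wltv.
by case/orP: (lt_weak w mltu); apply/negP; [apply: mmax|apply: wmax].
Qed.

(** The degree bound makes normal forms usable for counting dimensions later. *)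
Let reducible d f := exists g, J (f - g) /\
  forall m, m \in msupp g -> ~~ M m /\ (mdeg m < d)%N.

Lemma reducible0 d : reducible d 0.
Proof.
by exists 0; split=> [|m]; rewrite ?subr0 ?msupp0 //; exact: ideal_gen0.
Qed.

Lemma reducible_lin d c f g :
  reducible d f -> reducible d g -> reducible d (c *: f + g).
Proof.
move=> [f' [Jf f'M]] [g' [Jg g'M]]; exists (c *: f' + g'); split.
  by rewrite opprD addrACA -scalerBr; apply: ideal_genD Jg; apply: ideal_genZ.
move=> m /msuppD_le; rewrite mem_cat => /orP[/msuppZ_le|]; [exact: f'M|exact: g'M].
Qed.

(** Well-founded induction: for u in [M], ['X_[u] - B u] is congruent to ['X_[u]] and has only
    smaller monomials, all of the same degree. *)
Lemma reducible_monomial u : reducible (mdeg u).+1 'X_[u].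
Proof.
elim/lt_ind: u => u IH; case: (boolP (M u)) => Mu; last first.
  exists 'X_[u]; split; first by rewrite subrr; exact: ideal_gen0.
  by move=> m; rewrite msuppX inE => /eqP ->.
have [g [Jg gM]] : reducible (mdeg u).+1 ('X_[u] - B u).
  rewrite [B u]mpolyE (bigD1_seq u) ?msupp_uniq //=; last first.
    by rewrite mcoeff_msupp B_lead ?oner_eq0.
  rewrite B_lead // scale1r opprD addrA subrr add0r -sumrN big_seq_cond.
  elim/big_ind: _ => [||m /andP[mB mu]].
  - exact: reducible0.
  - by move=> f g rf rg; rewrite -[f]scale1r; apply: reducible_lin.
  have [mlt mdegE] := B_low Mu mB mu.
  rewrite -scaleNr -[_ *: _]addr0; apply: reducible_lin (reducible0 _).
  by rewrite -mdegE; apply: IH.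
exists g; split=> //; have -> : 'X_[u] - g = 'X_[u] - B u - g + B u.
  by rewrite addrAC subrK.
exact: ideal_genD Jg (B_ideal Mu).
Qed.

Lemma normal_form f : exists g, J (f - g) /\
  forall m, m \in msupp g -> ~~ M m /\ (mdeg m < msize f)%N.
Proof.
rewrite -/(reducible _ f) [X in reducible _ X]mpolyE big_seq.
elim/big_ind: _ => [||m mf]; first exact: reducible0.
  by move=> g h rg rh; rewrite -[g]scale1r; apply: reducible_lin.
rewrite -[_ *: _]addr0; apply: reducible_lin (reducible0 _).
have [g [Jg gM]] := reducible_monomial m; exists g; split=> // t /gM[? le].
by split=> //; apply: leq_trans le (msize_mdeg_lt mf).
Qed.

(** A weight order leaves ties, so a polynomial may have several maximal monomials. Breaking ties by
    the library order gives a total order that is still compatible with products. *)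
Let tot a b := lt a b || (~~ lt b a && (a < b)%O).

Lemma tot_add2r a b c : tot (a + c)%MM (b + c)%MM = tot a b.
Proof. by rewrite /tot !lt_add2r ltmc_add2l. Qed.

Lemma tot_trans : transitive tot.
Proof.
have nlt a b c : ~~ lt a b -> ~~ lt b c -> ~~ lt a c.
  by move=> nab nbc; apply: contraNN nab => /(lt_weak b) /orP[|/(negP nbc)].
move=> b a c /orP[ab|/andP[nba ab]] /orP[bc|/andP[ncb bc]]; rewrite /tot.
- by rewrite (lt_trans ab bc).
- by case/orP: (lt_weak c ab) => [->//|cb]; rewrite cb in ncb.
- by case/orP: (lt_weak a bc) => [ba|->//]; rewrite ba in nba.
- by rewrite (nlt _ _ _ ncb nba) (Order.POrderTheory.lt_trans ab bc) orbT.
Qed.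

Lemma tot_irr : irreflexive tot.
Proof. by move=> a; rewrite /tot lt_irr Order.POrderTheory.ltxx. Qed.

Lemma tot_total a b : a != b -> tot a b || tot b a.
Proof.
move=> ab; rewrite /tot.
by case: (boolP (lt a b)); case: (boolP (lt b a)) => //= _ _;
  rewrite -Order.TotalTheory.neq_lt.
Qed.

Let totmax (f : {mpoly K[N]}) m := m \in msupp f /\ forall a, a \in msupp f -> a != m -> tot a m.

Lemma totmax_exists f : f != 0 -> exists m, totmax f m.
Proof.
rewrite -msupp_eq0 /totmax; elim: (msupp f) => // a U IH _.
case: (eqVneq U [::]) => [->|/IH[u [uU umax]]].
  by exists a; split; rewrite ?mem_head // => v; rewrite inE => /eqP ->; rewrite eqxx.
case: (boolP (tot u a)) => [ua|nua].
  exists a; split; first exact: mem_head.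
  move=> v; rewrite inE => /orP[/eqP ->|vU]; first by rewrite eqxx.
  by have [->//|vu _] := eqVneq v u; apply: tot_trans (umax v vU vu) ua.
exists u; split; first by rewrite inE uU orbT.
move=> v; rewrite inE => /orP[/eqP -> /tot_total|/umax//].
by rewrite (negPf nua) orbF.
Qed.

(** Every other pair of monomials has a strictly smaller sum, so the top coefficient of the product
    is a product of two nonzero scalars. *)
Lemma totmaxM f g m n : totmax f m -> totmax g n -> totmax (f * g) (m + n)%MM.
Proof.
move=> [mf mmax] [ng nmax].
have sum_tot a b : a \in msupp f -> b \in msupp g -> (a, b) != (m, n) ->
    tot (a + b)%MM (m + n)%MM.
  move=> af bg; rewrite xpair_eqE negb_and.
  case: (eqVneq a m) => [->|/(mmax _ af) am] /=.
    by move/(nmax _ bg); rewrite ![(m + _)%MM]addmC tot_add2r.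
  case: (eqVneq b n) => [->|/(nmax _ bg) bn] _; first by rewrite tot_add2r.
  apply: (@tot_trans (m + b)%MM); first by rewrite tot_add2r.
  by rewrite ![(m + _)%MM]addmC tot_add2r.
split; last first.
  move=> c /msuppM_le /allpairsP[[a b] /= [af bg ->]] abmn; apply: sum_tot => //.
  by apply: contraNneq abmn => -[-> ->].
rewrite mcoeff_msupp mpolyME raddf_sum /=.
rewrite big_allpairs /= (bigD1_seq m) ?msupp_uniq //= (bigD1_seq n) ?msupp_uniq //=.
have coefE a b : ((f@_a * g@_b) *: 'X_[a + b])@_(m + n)%MM
    = f@_a * g@_b * ((a + b)%MM == (m + n)%MM)%:R by rewrite mcoeffZ mcoeffX.
rewrite coefE eqxx mulr1 big1_seq ?addr0; last first.
  move=> b /andP[bn bg]; rewrite coefE; case: eqP => [e|]; last by rewrite mulr0.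
  by have := sum_tot m b mf bg; rewrite e tot_irr xpair_eqE negb_and bn orbT => /(_ isT).
rewrite big1_seq ?addr0; last first.
  move=> a /andP[am af]; rewrite big1_seq // => b /= bg.
  rewrite coefE; case: eqP => [e|]; last by rewrite mulr0.
  by have := sum_tot a b af bg; rewrite e tot_irr xpair_eqE negb_and am => /(_ isT).
by rewrite mulf_neq0 // -mcoeff_msupp.
Qed.

Lemma totmaxX f m k : totmax f m -> totmax (f ^+ k) (m *+ k)%MM.
Proof.
move=> fm; elim: k => [|k IH]; last by rewrite exprS mulmS; apply: totmaxM.
rewrite expr0 mulm0n; split; first by rewrite msupp1 mem_head.
by move=> a; rewrite msupp1 inE => /eqP ->; rewrite eqxx.
Qed.

(** A nonzero normal form g of f has a [tot]-leading monomial m. The power of g lies in [J] and its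
    leading monomial, a multiple of m, is also maximal for [lt], hence in [M]. Then m is in [M],
    which a normal form excludes. *)
Lemma squarefree_radical :
  (forall m k, M (m *+ k)%MM -> M m) -> radical_ideal J.
Proof.
move=> Msqf f k Jfk; have [g [Jfg gM]] := normal_form f.
have Jgk := ideal_gen_exp Jfg Jfk.
case: (eqVneq g 0) => [g0|/totmax_exists[m mmax]]; first by rewrite g0 subr0 in Jfg.
have [mk kmax] := totmaxX k mmax.
have /Msqf Mm : M (m *+ k)%MM.
  apply: top_monomial Jgk mk _ => a /kmax; case: eqVneq => [->|_]; first by rewrite lt_irr.
  move=> /(_ isT) /orP[aL|/andP[]//]; apply/negP => /lt_trans /(_ aL).
  by rewrite lt_irr.
by have := (gM m mmax.1).1; rewrite Mm.
Qed.

End StandardMonomials.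

(** * Counting independent polynomials modulo an ideal *)

Section Counting.
Local Open Scope ring_scope.
Variables (K : fieldType) (N : nat).

Definition indep_mod (I : finType) (P : set {mpoly K[N]})
    (b : I -> {mpoly K[N]}) : Prop :=
  forall c : I -> K, P (\sum_i c i *: b i) -> forall i, c i = 0.

(** If the [g i], which use at most [#|L|] monomials, were more numerous than these monomials, their
    coefficient matrix would have a nonzero left kernel vector. It would be a linear relation among
    the [b i] modulo the ideal. *)
Lemma indep_mod_card (I L : finType) (S : set {mpoly K[N]})
    (b g : I -> {mpoly K[N]}) (s : L -> 'X_{1..N}) :
  indep_mod (ideal_gen S) b -> (forall i, ideal_gen S (b i - g i)) ->
  (forall i m, m \in msupp (g i) -> exists l, m = s l) ->
  (#|I| <= #|L|)%N.
Proof.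
move=> ind Sg gs; rewrite leqNgt; apply/negP => lt_LI.
pose A : 'M[K]_(#|I|, #|L|) := \matrix_(i, l) (g (enum_val i))@_(s (enum_val l)).
have ker0 : kermx A != 0.
  rewrite kermx_eq0 /row_free; apply: contraTneq lt_LI => <-.
  by rewrite -leqNgt rank_leq_col.
have [r /sub_kermxP rA r0] := rowV0Pn ker0.
pose c i := r 0 (enum_rank i).
have g0 : \sum_i c i *: g i = 0.
  apply/mpolyP => m; rewrite raddf_sum mcoeff0 /=.
  case: (pselect (exists l, m = s l)) => [[l ->]|nl]; last first.
    apply: big1 => i _; rewrite mcoeffZ memN_msupp_eq0 ?mulr0 //.
    by apply/negP => /gs.
  transitivity ((r *m A) 0 (enum_rank l)); last by rewrite rA mxE.
  rewrite [RHS]mxE.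
  rewrite [RHS](reindex_onto (@enum_rank I) (@enum_val I predT)) => [|i _]; last exact: enum_valK.
  rewrite [RHS](eq_bigl predT) => [|i]; last by rewrite enum_rankK eqxx.
  by apply: eq_bigr => i _; rewrite mxE mcoeffZ !enum_rankK.
case/negP: r0; apply/eqP/rowP => i; rewrite mxE -[i]enum_valK.
apply: (ind c); rewrite -[\sum_i _]subr0 -[X in _ - X]g0 -sumrB.
by apply: ideal_gen_sum => j _ _; rewrite -scalerBr; apply: ideal_genZ.
Qed.

End Counting.

Lemma exponent_bound a b C c : (0 < C)%N ->
  (forall E, (0 < E)%N -> (E ^ a <= C * (c * E + 1) ^ b)%N) -> (a <= b)%N.
Proof.
move=> C0 bound; rewrite leqNgt; apply/negP => ltba.
(* At E = D + 1 one has c E + 1 <= (c + 1) E, so the bound is at most D E^b < E^(b+1), and this is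
   at most E^a when b < a. *)
set D := (C * c.+1 ^ b)%N; have := bound D.+1 isT; apply/negP; rewrite -ltnNge.
apply: (@leq_trans (D.+1 ^ b.+1)); last exact: leq_pexp2l.
rewrite expnS; apply: (@leq_ltn_trans (D * D.+1 ^ b)); last first.
  by rewrite ltn_mul2r expn_gt0 /= ltnS.
rewrite /D -mulnA leq_mul2l -expnMn; apply/orP; right.
by case: (b) => // b'; rewrite leq_exp2r // mulSn addnC leq_add2r.
Qed.

(** * Heights of prime ideals in polynomial rings *)

Section PrimeIdeals.
Local Open Scope ring_scope.
Local Open Scope classical_set_scope.
Variable R : comNzRingType.
Implicit Types (P Q : set R) (f g a : R).

Lemma prime_idealE P : prime_ideal P <->
  [/\ P 0, ~ P 1, forall a u v, P u -> P v -> P (a * u + v)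
    & forall u v, P (u * v) -> P u \/ P v].
Proof.
rewrite /prime_ideal /idealr_closed /prime_idealr_closed; split.
  case=> -[P0 P1 Plin] Ppr; split.
  - by move: P0; rewrite in_setE.
  - by move=> p1; move: P1; rewrite (mem_set p1).
  - by move=> a u v /mem_set uP /mem_set vP; apply/set_mem/Plin.
  - by move=> u v /mem_set/Ppr/orP[]/set_mem; [left|right].
case=> P0 P1 Plin Ppr; split; first split.
- exact/mem_set.
- by apply/negP => /set_mem.
- by move=> a u v /set_mem uP /set_mem vP; apply/mem_set/Plin.
- by move=> u v /set_mem/Ppr[]/mem_set ->; rewrite ?orbT.
Qed.

Section Closure.
Variables (P : set R) (Pprime : prime_ideal P).

Lemma prime_ideal0 : P 0.
Proof. by case/prime_idealE: Pprime. Qed.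

Lemma prime_ideal1 : ~ P 1.
Proof. by case/prime_idealE: Pprime. Qed.

Lemma prime_idealM a f : P f -> P (a * f).
Proof.
case/prime_idealE: Pprime => P0 _ Plin _ Pf.
by rewrite -[_ * _]addr0; apply: Plin.
Qed.

Lemma prime_idealD f g : P f -> P g -> P (f + g).
Proof.
case/prime_idealE: Pprime => _ _ Plin _ Pf Pg.
by rewrite -[f]mul1r; apply: Plin.
Qed.

Lemma prime_idealB f g : P f -> P g -> P (f - g).
Proof. by move=> Pf Pg; apply: prime_idealD Pf _; rewrite -mulN1r; apply: prime_idealM. Qed.

Lemma prime_ideal_or f g : P (f * g) -> P f \/ P g.
Proof. by case/prime_idealE: Pprime => _ _ _; apply. Qed.

Lemma prime_ideal_sum (I : Type) (r : seq I) (p : pred I) (F : I -> R) :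
  (forall i, p i -> P (F i)) -> P (\sum_(i <- r | p i) F i).
Proof.
by move=> PF; elim/big_ind: _ => //; [exact: prime_ideal0|exact: prime_idealD].
Qed.

End Closure.

Lemma prime_chain_shorten P r h : prime_chain_to P r -> (h <= r)%N -> prime_chain_to P h.
Proof.
move=> [Q [Qp Qs QP]] hr; exists (fun i => Q (i + (r - h))%N); split.
- by move=> i ih; apply: Qp; rewrite -[X in (_ <= X)%N](subnKC hr) leq_add2r.
- by move=> i ih; apply: Qs; rewrite -[X in (_ < X)%N](subnKC hr) ltn_add2r.
- by rewrite subnKC.
Qed.

(** By Zorn's lemma there is an ideal maximal among those that contain S and avoid the
    multiplicative set T; such an ideal is prime. *)
Lemma prime_avoiding (S T : set R) :
  T 1 -> (forall f g, T f -> T g -> T (f * g)) ->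
  (forall f, ideal_gen S f -> ~ T f) ->
  exists P, [/\ prime_ideal P, S `<=` P & forall f, P f -> ~ T f].
Proof.
move=> T1 TM ST.
pose lin (A : set R) := forall a u v, A u -> A v -> A (a * u + v).
pose good (A : set R) := [/\ A 0, lin A, S `<=` A & forall f, A f -> ~ T f].
have [F Fgood Ftot|P [Pg Pmax]] := @Zorn_bigcup R [set A | A = set0 \/ good A].
  have [F0|] := pselect (F `<=` [set set0]).
    by left; apply/seteqP; split=> // x [A /F0 -> []].
  move=> /existsNP[A /not_implyP[FA A0]].
  have gA : good A by case: (Fgood A FA).
  have gF D x : F D -> D x -> good D by move=> FD Dx; case: (Fgood D FD) Dx => [->|].
  right; split.
  - by exists A => //; case: gA.
  - move=> a u v [D FD Du] [D' FD' Dv].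
    case: (Ftot _ _ FD FD') => sub.
      by exists D' => //; case: (gF _ _ FD' Dv) => _ l _ _; apply: l Dv; apply: sub.
    by exists D => //; case: (gF _ _ FD Du) => _ l _ _; apply: l (sub _ Dv).
  - by move=> x Sx; exists A => //; case: gA => _ _ + _; apply.
  - by move=> f [D FD Df]; case: (gF _ _ FD Df) => _ _ _; apply.
have genT : good (ideal_gen S).
  split; [exact: ideal_gen0| |exact: ideal_gen_sub|exact: ST].
  by move=> a u v Su Sv; apply: ideal_genD Sv; apply: ideal_genM.
case: Pg => [P0|[P0 Plin SP PT]].
  case: (Pmax (ideal_gen S)); last by right.
  by rewrite P0; split=> // sub; apply: (sub 0); case: genT.
exists P; split=> //; apply/prime_idealE; split=> //; first by move=> /PT; apply.
have Pmul a f : P f -> P (a * f) by move=> Pf; rewrite -[_ * _]addr0; apply: Plin.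
(* By maximality, P together with any f outside P generates an ideal that meets T. If u and v were
   outside P with u v in P, the product of two such elements of T would lie in P. *)
have meet f : ~ P f -> exists p a, P p /\ T (p + a * f).
  move=> nPf; pose P' := [set g | exists p a, P p /\ g = p + a * f].
  have PP' : P `<` P'.
    split=> [g Pg|sub]; first by exists g, 0; rewrite mul0r addr0.
    by apply/nPf/sub; exists 0, 1; rewrite mul1r add0r.
  apply: contrapT => nex; apply: (Pmax P' PP'); right; split.
  - by exists 0, 0; rewrite mul0r addr0.
  - move=> a _ _ [p [b [Pp ->]]] [q [c [Pq ->]]]; exists (a * p + q), (a * b + c).
    by split; [exact: Plin|rewrite mulrDl mulrDr addrACA mulrA].
  - by move=> g /SP Pg; exists g, 0; rewrite mul0r addr0.
  - by move=> _ [p [a [Pp ->]]] Tg; apply: nex; exists p, a.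
move=> u v Puv; apply: contrapT => /not_orP[/meet[p [a [Pp Tu]]] /meet[q [b [Pq Tv]]]].
apply: (PT _ _ (TM _ _ Tu Tv)).
rewrite mulrDl [p * _]mulrC; apply: (Plin _ _ _ Pp).
rewrite mulrDr; apply: Plin => //; rewrite mulrACA; exact: Pmul.
Qed.

End PrimeIdeals.

Lemma leq_exp_base m n e : (m <= n)%N -> (m ^ e <= n ^ e)%N.
Proof. by case: e => // e; rewrite leq_exp2r. Qed.

(** * Bounding heights and independent variables by growth of dimensions *)

Section HeightUpperBound.
Local Open Scope ring_scope.
Local Open Scope classical_set_scope.
Variables (K : fieldType) (N : nat).
Local Notation R := {mpoly K[N]}.

Definition deg_le (d : nat) (f : R) := forall m, m \in msupp f -> (mdeg m <= d)%N.

Lemma deg_leM d e f g : deg_le d f -> deg_le e g -> deg_le (d + e) (f * g).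
Proof.
move=> df eg m /msuppM_le /allpairsP[[a b] /= [af bg ->]].
by rewrite mdegD leq_add ?df ?eg.
Qed.

Lemma deg_leX d f k : deg_le d f -> deg_le (d * k) (f ^+ k).
Proof.
move=> df; elim: k => [|k IH]; last by rewrite exprS mulnS; apply: deg_leM.
by move=> m; rewrite expr0 msupp1 inE => /eqP ->; rewrite mdeg0.
Qed.

Lemma deg_le_msize f : deg_le (msize f) f.
Proof. by move=> m /msize_mdeg_lt /ltnW. Qed.

(* Substituting [0] for [f] modulo [P] kills all terms but the first. *)
Lemma indep_mod_powers (I : finType) (P Q : set R) (b : I -> R) (f : R) E
    (c : nat -> I -> K) :
  prime_ideal P -> prime_ideal Q -> Q `<=` P -> indep_mod P b -> P f -> ~ Q f ->
  Q (\sum_(e < E) (\sum_i c e i *: b i) * f ^+ e) ->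
  forall e i, (e < E)%N -> c e i = 0.
Proof.
move=> Pp Qp QP ind Pf Qf; elim: E c => // E IH c.
rewrite big_ord_recl expr0 mulr1 => Qs.
have sE : \sum_(e < E) (\sum_i c (lift ord0 e) i *: b i) * f ^+ lift ord0 e
    = (\sum_(e < E) (\sum_i c e.+1 i *: b i) * f ^+ e) * f.
  by rewrite mulr_suml; apply: eq_bigr => e _; rewrite /= /bump /= exprSr mulrA.
rewrite {}sE in Qs; set s := \sum_(e < E) _ in Qs.
have c0 : forall i, c 0%N i = 0.
  apply: ind; rewrite -[X in P X](addrK (s * f)).
  by apply: prime_idealB (QP _ Qs) _ => //; apply: prime_idealM.
rewrite big1 ?add0r in Qs; last by move=> i _; rewrite c0 scale0r.
have {Qs} Qs : Q s by case: (prime_ideal_or Qp Qs).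
by case=> [|e] i lte //; apply: (IH (fun e => c e.+1)).
Qed.

Lemma indep_mod_step (I : finType) (P Q : set R) (b : I -> R) (f : R) E :
  prime_ideal P -> prime_ideal Q -> Q `<=` P -> indep_mod P b -> P f -> ~ Q f ->
  indep_mod Q (fun ie : I * 'I_E.+1 => b ie.1 * f ^+ ie.2).
Proof.
move=> Pp Qp QP ind Pf Qf c Qs.
suff H : forall e i, (e < E.+1)%N -> c (i, inord e) = 0.
  by case=> i e; rewrite -[e]inord_val; apply: H.
apply: (indep_mod_powers (c := fun e i => c (i, inord e)) Pp Qp QP ind Pf Qf).
move: Qs; congr (Q _).
rewrite (eq_bigr (fun x => c (x.1, x.2) *: (b x.1 * f ^+ x.2))); last by case.
rewrite -(pair_bigA _ (fun i (e : 'I_E.+1) => c (i, e) *: (b i * f ^+ e))) /=.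
rewrite exchange_big /=; apply: eq_bigr => e _.
by rewrite mulr_suml; apply: eq_bigr => i _; rewrite inord_val scalerAl.
Qed.

(** Each strict inclusion supplies an f in the larger prime outside the smaller one, and its powers
    up to E multiply the size of the family by E + 1. The constant D depends on the chain alone, so
    the degrees grow only linearly in E. *)
Lemma indep_mod_chain (m : nat) (Q : nat -> set R) :
  (forall i, (i <= m)%N -> prime_ideal (Q i)) ->
  (forall i, (i < m)%N -> Q i `<` Q i.+1) ->
  exists D, forall E (I : finType) (b : I -> R), indep_mod (Q m) b ->
  exists (I' : finType) (b' : I' -> R),
    [/\ indep_mod (Q 0%N) b', #|I'| = (#|I| * E.+1 ^ m)%N
      & forall d, (forall i, deg_le d (b i)) ->
          forall i, deg_le (d + D * E) (b' i)].
Proof.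
elim: m => [|m IH] Qp Qs.
  exists 0%N => E I b ind; exists I, b.
  by rewrite expn0 muln1; split=> // d db i; rewrite mul0n addn0; apply: db.
have [QQ /nonsubset[f [Qf nQf]]] := Qs m (ltnSn m).
have [D HD] := IH (fun i im => Qp i (leqW im)) (fun i im => Qs i (leqW im)).
exists (D + msize f)%N => E I b ind.
have ind' := indep_mod_step (E := E) (Qp _ (leqnn _)) (Qp _ (leqnSn m)) QQ ind Qf nQf.
have [I' [b' [indb' cI' db']]] := HD E _ _ ind'.
exists I', b'; split=> //; first by rewrite cI' card_prod card_ord expnS mulnA.
move=> d db i; rewrite mulnDl addnA addnAC.
apply: db' => -[{}i e]; apply: deg_leM (db i) _ => /=.
move=> t /(deg_leX (@deg_le_msize f)) /leq_trans; apply.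
by rewrite leq_mul2l -ltnS ltn_ord orbT.
Qed.

Definition supported (Y : {set 'I_N}) (f : R) :=
  forall m, m \in msupp f -> forall v, v \notin Y -> m v = 0%N.

(** The classes of the variables in Y modulo P are algebraically independent over K. *)
Definition indep_vars (Y : {set 'I_N}) (P : set R) :=
  forall f, supported Y f -> P f -> f = 0.

Lemma indep_vars_mod Y P E : indep_vars Y P ->
  exists (I : finType) (b : I -> R),
    [/\ indep_mod P b, #|I| = (E.+1 ^ #|Y|)%N & forall i, deg_le (N * E) (b i)].
Proof.
move=> indY.
pose I := {a : {ffun 'I_N -> 'I_E.+1} | a \in pffun_on ord0 Y predT}.
pose mon (a : I) : 'X_{1..N} := [multinom (val a v : nat) | v < N].
have mon_inj : injective mon.
  move=> a a' /mnmP e; apply/val_inj/ffunP => v; apply/val_inj.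
  by have := e v; rewrite !mnmE.
exists I, (fun a => 'X_[mon a]); split.
- move=> c Pc a; have s0 : \sum_i c i *: 'X_[mon i] = 0 :> R.
    apply: indY Pc => m /msupp_sum_le /flattenP[_ /mapP[i _ ->]] /msuppZ_le.
    rewrite msuppX inE => /eqP -> v vY; rewrite mnmE.
    have /pffun_onP[/fintype.subsetP sY _] := valP i.
    by apply/eqP; apply: contraNT vY => nz; apply: sY; rewrite inE.
  have := congr1 (mcoeff (mon a)) s0; rewrite raddf_sum mcoeff0 (bigD1 a) //=.
  rewrite mcoeffZ mcoeffX eqxx mulr1 big1 ?addr0 // => i ia.
  by rewrite mcoeffZ mcoeffX (inj_eq mon_inj) (negPf ia) mulr0.
- by rewrite card_sig card_pffun_on card_ord.
- move=> i m; rewrite msuppX inE => /eqP ->; rewrite mdegE.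
  rewrite (leq_trans (leq_sum (E2 := fun=> E) _ _)) ?sum_nat_const ?card_ord //.
  by move=> v _; rewrite mnmE -ltnS.
Qed.

Lemma mdeg_ge_exp (m : 'X_{1..N}) v : (m v <= mdeg m)%N.
Proof. by rewrite mdegE (bigD1 v) //= leq_addr. Qed.

(** Monomials in Y with exponents up to E, multiplied by the powers coming from the chain, give
    [E.+1 ^ (#|Y| + m)] independent polynomials of degree linear in E. The number of monomials of
    such degrees grows at most like E^N. *)
Lemma height_le_codim Y P m :
  prime_chain_to P m -> indep_vars Y P -> (#|Y| + m <= N)%N.
Proof.
move=> [Q [Qp Qs QP]] indY; have [D HD] := indep_mod_chain Qp Qs.
apply: (@exponent_bound _ _ 1 (N + D)) => // -[//|E] _; rewrite mul1n.
have [I [b [indb cI db]]] := indep_vars_mod E indY.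
rewrite -QP in indb; have [I' [b' [indb' cI' db']]] := HD E I b indb.
set d := (N * E + D * E)%N in db'.
(* Without generators the ideal is zero, so this counts plain linear independence; monomials are
   coded by exponents up to d. *)
have := @indep_mod_card K N I' {ffun 'I_N -> 'I_d.+1} set0 b' b'
  (fun a => [multinom (a v : nat) | v < N]).
rewrite cI' cI -expnD card_ffun !card_ord => H.
apply: (@leq_trans (d.+1 ^ N)); last first.
  by apply: leq_exp_base; rewrite addn1 ltnS /d -mulnDl leq_mul2l leqnSn orbT.
apply: H.
- move=> c [s s0 sE]; apply: indb'; rewrite sE.
  rewrite big_seq big1 => [|ab /s0 //]; exact: prime_ideal0 (Qp 0%N _).
- by move=> i; rewrite subrr; apply: ideal_gen0.
- move=> i t ti; exists [ffun v => inord (t v)]; apply/mnmP => v.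
  rewrite mnmE ffunE inordK // ltnS (leq_trans (mdeg_ge_exp t v)) //.
  exact: db' db _ _ ti.
Qed.

(** Normal forms express the [E.+1 ^ #|Y|] independent monomials by standard monomials of degree at
    most N E. As each of these involves at most r variables, there are at most 2^N (N E + 1)^r of
    them. *)
Lemma indep_vars_standard_bound (Y : {set 'I_N}) (S : set R) (M : pred 'X_{1..N}) r :
  indep_vars Y (ideal_gen S) ->
  (forall f, exists g, ideal_gen S (f - g) /\
     forall m, m \in msupp g -> ~~ M m /\ (mdeg m < msize f)%N) ->
  (forall m, ~~ M m -> (#|[set v | m v != 0%N]%SET| <= r)%N) ->
  (#|Y| <= r)%N.
Proof.
move=> indY nf Mr; apply: (@exponent_bound _ _ (2 ^ N) N) => [|[//|E] _].
  by rewrite expn_gt0.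
have [I [b [indb cI db]]] := indep_vars_mod E indY.
have /choice[g Hg] i := nf (b i).
set d := (N * E)%N in db.
(* A monomial is coded by its support and its exponents along the enumeration of the support.
   Positions from r on, where [insub] fails, get the default exponent 0; supports of size at most r
   have no such position. *)
pose s (Wh : {set 'I_N} * {ffun 'I_r -> 'I_d.+1}) : 'X_{1..N} :=
  [multinom if v \in Wh.1 then oapp (fun j => (Wh.2 j : nat)) 0%N
     (insub (index v (enum Wh.1))) else 0%N | v < N].
have := @indep_mod_card K N I _ S b g s indb (fun i => (Hg i).1).
rewrite cI card_prod card_ffun !card_ord -cardsT -powersetT card_powerset cardsT card_ord.
move=> H; apply: (@leq_trans (2 ^ N * d.+1 ^ r)); last first.
  by rewrite leq_mul2l leq_exp_base ?orbT // addn1 ltnS /d leq_mul2l leqnSn orbT.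
apply: H => i m mg; have [Mm degm] := (Hg i).2 m mg.
pose W := [set v | m v != 0%N]%SET.
exists (W, [ffun j : 'I_r => inord (nth 0%N [seq m v | v <- enum W] j)]).
apply/mnmP => v; rewrite mnmE /= inE; case: eqP => //= /eqP mv.
have vW : v \in enum W by rewrite mem_enum inE.
have idx : (index v (enum W) < r)%N.
  by apply: leq_trans (Mr m Mm); rewrite cardE index_mem.
rewrite insubT /= ffunE /= (nth_map v) ?index_mem // nth_index // inordK //.
rewrite ltnS (leq_trans (mdeg_ge_exp m v)) //.
rewrite -ltnS (leq_trans degm) // msizeE; apply/bigmax_leqP_seq => t tb _.
by rewrite ltnS; apply: db tb.
Qed.

End HeightUpperBound.

(** * Building chains of primes by eliminating variables *)

Section PolynomialsOverPrime.
Local Open Scope ring_scope.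
Local Open Scope classical_set_scope.
Variables (R : idomainType) (N : nat) (P : set R) (Pprime : prime_ideal P).
Implicit Types F G : {mpoly R[N]}.

Definition coefs_in F := forall e, P F@_e.

Lemma coefs_inD F G : coefs_in F -> coefs_in G -> coefs_in (F + G).
Proof. by move=> PF PG e; rewrite mcoeffD; apply: prime_idealD. Qed.

Lemma coefs_inM F G : coefs_in G -> coefs_in (F * G).
Proof.
move=> PG e; rewrite mcoeffM; apply: prime_ideal_sum => // i _.
exact: prime_idealM.
Qed.

(* Drop the terms with coefficients in [P] and compare leading coefficients. *)
Lemma coefs_in_prime F G : coefs_in (F * G) -> coefs_in F \/ coefs_in G.
Proof.
pose low F := \sum_(m <- msupp F) (if `[< P F@_m >] then 0 else F@_m) *: 'X_[m].
have lowE H m : (low H)@_m = if `[< P H@_m >] then 0 else H@_m.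
  have termE (c : R) t : (c *: 'X_[t] : {mpoly R[N]})@_m = c * (t == m)%:R.
    by rewrite mcoeffZ mcoeffX.
  rewrite /low raddf_sum /=; case: (boolP (m \in msupp H)) => mH.
    rewrite (bigD1_seq m) ?msupp_uniq //= termE eqxx mulr1.
    by rewrite big1 ?addr0 // => t /negPf tm; rewrite termE tm mulr0.
  rewrite (memN_msupp_eq0 mH) if_same big1_seq // => t /= tH; rewrite termE.
  by case: eqP => [tm|]; [rewrite tm (negPf mH) in tH|rewrite mulr0].
have lowP H : coefs_in (H - low H).
  move=> m; rewrite mcoeffB lowE; case: asboolP => Hm; first by rewrite subr0.
  by rewrite subrr; apply: prime_ideal0.
have low0 H : ~ coefs_in H -> low H != 0 /\ ~ P (low H)@_(mlead (low H)).
  move=> nH; have l0 : low H != 0.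
    apply: contra_notN nH => /eqP l0; have := lowP H; rewrite l0 subr0; exact.
  split=> //; have := mlead_supp l0; rewrite mcoeff_msupp lowE.
  by case: asboolP; rewrite ?eqxx.
move=> PFG; apply: contrapT => /not_orP[/low0[F0 PF] /low0[G0 PG]].
have PL : coefs_in (low F * low G).
  have -> : low F * low G = (low F - F) * low G + (low G - G) * F + F * G.
    by rewrite !mulrBl [low G * F]mulrC [G * F]mulrC addrA subrK subrK.
  have swap H : coefs_in (low H - H).
    by rewrite -opprB -mulN1r; apply: coefs_inM.
  by apply: coefs_inD => //; apply: coefs_inD; rewrite mulrC; apply: coefs_inM.
have := PL (mlead (low F) + mlead (low G))%MM.
by rewrite mleadcM => /(prime_ideal_or Pprime)[].
Qed.

End PolynomialsOverPrime.

Section HeightLowerBound.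
Local Open Scope ring_scope.
Local Open Scope classical_set_scope.
Variables (K : fieldType) (N : nat).
Local Notation R := {mpoly K[N]}.

Lemma mpoly_rmorph_ext (S : nzRingType) (F G : {rmorphism R -> S}) :
  (forall c, F c%:MP = G c%:MP) -> (forall i, F 'X_i = G 'X_i) -> F =1 G.
Proof.
move=> FC FX f; rewrite [f]mpolyE !rmorph_sum; apply: eq_bigr => m _.
rewrite -mul_mpolyC !rmorphM FC mpolyXE_id !rmorph_prod; congr (_ * _).
by apply: eq_bigr => i _; rewrite !rmorphXn /= FX.
Qed.

(* [split_vars W] reads a polynomial as one in the variables outside [W], with
   coefficients in the variables of [W]. *)
Definition split_vars (W : pred 'I_N) : R -> {mpoly R[N]} :=
  mmap (@mpolyC N R \o @mpolyC N K) (fun v => if W v then ('X_v)%:MP else 'X_v).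
HB.instance Definition _ (W : pred 'I_N) :=
  GRing.RMorphism.on (split_vars W).

Definition mres (W : pred 'I_N) (m : 'X_{1..N}) : 'X_{1..N} :=
  [multinom if W v then m v else 0%N | v < N].

Lemma split_varsX W m :
  split_vars W 'X_[m] = 'X_[mres W m]%:MP * 'X_[mres (predC W) m].
Proof.
rewrite /split_vars mmapX /mmap1 !['X_[mres _ _]]mpolyXE_id rmorph_prod -big_split /=.
apply: eq_bigr => v _; rewrite !mnmE /=; case: (W v) => /=.
  by rewrite expr0 mulr1 rmorphXn.
by rewrite expr0 mpolyC1 mul1r.
Qed.

Lemma split_varsC W c : split_vars W c%:MP = c%:MP%:MP.
Proof. by rewrite /split_vars mmapC. Qed.

Lemma split_varsE W f : split_vars W f = \sum_(m <- msupp f)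
  (f@_m)%:MP%:MP * ('X_[mres W m]%:MP * 'X_[mres (predC W) m]).
Proof.
rewrite {1}[f]mpolyE (rmorph_sum (split_vars W)); apply: eq_bigr => m _.
by rewrite -mul_mpolyC (rmorphM (split_vars W)) /= split_varsC split_varsX.
Qed.

Lemma split_vars_coef W f e : (split_vars W f)@_e =
  \sum_(m <- msupp f | mres (predC W) m == e) f@_m *: 'X_[mres W m].
Proof.
rewrite split_varsE raddf_sum [RHS]big_mkcond; apply: eq_bigr => m _ /=.
rewrite mulrA -mpolyCM mul_mpolyC mcoeffZ mcoeffX mul_mpolyC.
by case: eqP; rewrite ?mulr1 ?mulr0.
Qed.

Section Elimination.
Variables (P : set R) (Pprime : prime_ideal P).

(* The extension to [R] of the contraction of [P] to the variables in [W]. *)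
Definition elim_ideal (W : pred 'I_N) : set R :=
  [set f | coefs_in P (split_vars W f)].

Lemma elim_ideal_prime W : prime_ideal (elim_ideal W).
Proof.
apply/prime_idealE; split; rewrite /elim_ideal /=.
- by move=> e; rewrite rmorph0 mcoeff0; apply: prime_ideal0.
- by move/(_ 0%MM); rewrite rmorph1 mcoeff1 eqxx; apply: prime_ideal1.
- move=> a u v Pu Pv; rewrite (rmorphD (split_vars W)) (rmorphM (split_vars W)).
  by refine (coefs_inD Pprime (coefs_inM Pprime _ Pu) Pv).
- move=> u v; rewrite (rmorphM (split_vars W)); exact: coefs_in_prime.
Qed.

(** Splitting along W' is splitting along W followed by the map [psi], which moves the variables of
    W' into the coefficients. [psi] is linear over the coefficient ring, so coefficients in P stay
    in P. *)
Lemma elim_ideal_sub (W W' : pred 'I_N) : subpred W W' ->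
  elim_ideal W `<=` elim_ideal W'.
Proof.
move=> WW' f Pf; rewrite /elim_ideal /=.
pose psi := mmap (@mpolyC N R) (fun v => if W' v then ('X_v : R)%:MP else 'X_v : {mpoly R[N]}).
pose psiM : {rmorphism {mpoly R[N]} -> {mpoly R[N]}} := psi.
have -> : split_vars W' f = psi (split_vars W f).
  apply: (@mpoly_rmorph_ext _ (split_vars W') (psiM \o split_vars W)) => [c|v] /=.
    by rewrite !split_varsC /psi mmapC.
  rewrite /split_vars !mmapX !mmap1U; case: (boolP (W v)) => Wv.
    by rewrite WW' // /psi mmapC.
  by rewrite /psi mmapX mmap1U.
rewrite /psi /mmap => e; rewrite raddf_sum /=; apply: prime_ideal_sum => // m _.
by rewrite mcoeffCM mulrC; apply: prime_idealM.
Qed.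

Lemma elim_idealT f : elim_ideal predT f <-> P f.
Proof.
have -> : elim_ideal predT f = coefs_in P (f%:MP : {mpoly R[N]}).
  rewrite /elim_ideal /=; congr coefs_in.
  apply: (@mpoly_rmorph_ext _ (split_vars predT) (@mpolyC N R)) => [c|v] /=.
    by rewrite split_varsC.
  by rewrite /split_vars mmapX mmap1U.
split=> [/(_ 0%MM)|Pf e]; rewrite mcoeffC ?eqxx ?mulr1 //.
by rewrite mulrC; apply: prime_idealM.
Qed.

Lemma elim_ideal_supported W f :
  (forall m, m \in msupp f -> forall v, ~~ W v -> m v = 0%N) ->
  P f -> elim_ideal W f.
Proof.
move=> fW Pf; suff -> : elim_ideal W f = coefs_in P (f%:MP : {mpoly R[N]}).
  by move=> e; rewrite mcoeffC mulrC; apply: prime_idealM.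
rewrite /elim_ideal /=; congr coefs_in.
rewrite split_varsE [f in RHS]mpolyE (raddf_sum (@mpolyC N R)).
apply: eq_big_seq => m mf /=; rewrite -[_ *: _]mul_mpolyC mpolyCM; congr (_ * _).
have -> : mres W m = m.
  by apply/mnmP => v; rewrite mnmE; case: ifP => // /negbT /(fW m mf) ->.
have -> : mres (predC W) m = 0%MM; last by rewrite mpolyX0 mulr1.
by apply/mnmP => v; rewrite mnmE mnm0E /=; case: ifP => // /(fW m mf) ->.
Qed.

(** An f in P in the variables v and Y lies in the ideal for W', hence in the one for W. So its
    coefficients as a polynomial in v lie in P; they involve only Y and therefore vanish. *)
Lemma elim_ideal_indep (W W' : pred 'I_N) (Y : {set 'I_N}) v :
  (forall i, i \in Y -> W i) -> ~~ W v -> W' =1 predU1 v W ->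
  elim_ideal W' `<=` elim_ideal W -> indep_vars Y P -> indep_vars (v |: Y)%SET P.
Proof.
move=> YW Wv W'E sub indY f suppf Pf.
have fW : elim_ideal W f.
  apply: sub; apply: elim_ideal_supported => // m mf i; rewrite W'E /= negb_or.
  move=> /andP[iv Wi]; apply: (suppf m mf).
  by rewrite !inE (negPf iv) /=; apply: contra Wi => /YW.
apply/eqP; rewrite -msupp_eq0; apply/negPn/negP => nz.
have [m0 m0f] : exists m0, m0 \in msupp f.
  by case: (msupp f) nz => // m0 ? _; exists m0; rewrite mem_head.
pose e := mres (predC W) m0.
have memf m u : m \in msupp f -> u != v -> u \notin Y -> m u = 0%N.
  by move=> mf uv uY; apply: (suppf m mf); rewrite !inE negb_or uv.
have resE m : m \in msupp f -> mres (predC W) m = e -> mres W m = mres W m0 -> m = m0.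
  move=> mf /mnmP em /mnmP Em; apply/mnmP => u; have := em u; have := Em u.
  by rewrite /e !mnmE /=; case: (W u).
have coefY : supported Y (split_vars W f)@_e.
  rewrite split_vars_coef => t /msupp_sum_le /flattenP[_ /mapP[m + ->]] /msuppZ_le.
  rewrite mem_filter msuppX inE => /andP[_ mf] /eqP -> u uY; rewrite mnmE.
  by case: ifP => // Wu; apply: memf => //; apply: contraTneq Wu => ->.
have := congr1 (mcoeff (mres W m0)) (indY _ coefY (fW e)); rewrite split_vars_coef.
rewrite raddf_sum mcoeff0 /= (bigID (pred1 m0)) /= addrC big1_seq ?add0r; last first.
  move=> m /andP[/andP[/eqP em mm0] mf]; rewrite mcoeffZ mcoeffX.
  by case: eqP => [/(resE _ mf em) /eqP|]; rewrite ?(negPf mm0) ?mulr0.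
rewrite big_mkcond (bigD1_seq m0) ?msupp_uniq //= !eqxx mcoeffZ mcoeffX eqxx mulr1.
rewrite big1 ?addr0 => [/eqP|m /negPf ->]; last by rewrite andbF.
by rewrite mcoeff_eq0 m0f.
Qed.

Lemma elim_chain i : (i <= N)%N -> exists (Y : {set 'I_N}) r,
  [/\ prime_chain_to (elim_ideal [pred v : 'I_N | (v < i)%N]) r,
      (#|Y| + r = i)%N, forall v, v \in Y -> (v < i)%N & indep_vars Y P].
Proof.
elim: i => [_|i IH ltiN].
  exists finset.set0, 0%N; split.
  - by exists (fun _ => elim_ideal [pred v : 'I_N | (v < 0)%N]); split=> // j _;
      apply: elim_ideal_prime.
  - by rewrite cards0.
  - by move=> v; rewrite inE.
  (* A polynomial in no variables is a constant, and a prime contains no nonzero constant. *)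
  move=> f f0 Pf; have fC : f = (f@_0%MM)%:MP.
    apply/mpolyP => m; rewrite mcoeffC; case: eqVneq => [->|m0]; first by rewrite mulr1.
    rewrite mulr0 memN_msupp_eq0 //; apply: contraNN m0 => /f0 mv.
    by apply/eqP/mnmP => v; rewrite mnm0E mv // inE.
  move: Pf; rewrite fC; have [->|nz] := eqVneq (f@_0%MM) 0; first by rewrite mpolyC0.
  move/(prime_idealM Pprime ((f@_0%MM)^-1)%:MP); rewrite -mpolyCM mulVf //.
  by move/(prime_ideal1 Pprime).
have [Y [r [[Q [Qp Qs Qr]] cY Yi indY]]] := IH (ltnW ltiN).
set W := [pred v : 'I_N | (v < i)%N] in Qr; set W' := [pred v : 'I_N | (v < i.+1)%N].
pose v := Ordinal ltiN.
have sWW' : elim_ideal W `<=` elim_ideal W'.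
  by apply: elim_ideal_sub => u /=; apply: leqW.
case: (pselect (elim_ideal W' `<=` elim_ideal W)) => [sub|nsub].
  exists (v |: Y)%SET, r; split.
  - exists Q; split; [exact: Qp|exact: Qs|rewrite Qr].
    by apply/seteqP; split; [exact: sWW'|exact: sub].
  - by rewrite cardsU1 -addnA cY; case: (boolP (v \in Y)) => // /Yi; rewrite ltnn.
  - by move=> u; rewrite !inE => /orP[/eqP ->|/Yi /leqW].
  apply: (elim_ideal_indep (W := W) (W' := W')) => //=; first by rewrite ltnn.
  by move=> u /=; rewrite ltnS leq_eqVlt.
exists Y, r.+1; split; [|by rewrite addnS cY|by move=> u /Yi /leqW|exact: indY].
exists (fun j => if (j <= r)%N then Q j else elim_ideal W'); split.
- by move=> j _; case: ifP => [/Qp //|_]; apply: elim_ideal_prime.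
- move=> j; rewrite ltnS => jr; rewrite jr; case: ltnP => [/Qs //|rj].
  have -> : j = r by apply/eqP; rewrite eqn_leq jr.
  by rewrite Qr; split; [exact: sWW'|exact: nsub].
- have E := ltnn r; rewrite E; reflexivity.
Qed.

Lemma codim_le_height h : (h <= N)%N ->
  (forall Y, indep_vars Y P -> (#|Y| <= N - h)%N) -> prime_chain_to P h.
Proof.
move=> hN Yle; have [Y [r [ch cY _ /Yle leY]]] := elim_chain (leqnn N).
apply: (@prime_chain_shorten _ _ r); last first.
  by rewrite -(leq_add2l #|Y|) cY -[X in (_ <= X)%N](subnK hN) leq_add2r.
move: ch; have -> //: elim_ideal [pred v : 'I_N | (v < N)%N] = P.
have -> : elim_ideal [pred v : 'I_N | (v < N)%N] = elim_ideal predT.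
  by apply/seteqP; split; apply: elim_ideal_sub => v /=; rewrite ?ltn_ord.
by apply/seteqP; split=> f /elim_idealT.
Qed.

End Elimination.
End HeightLowerBound.

(** * Paths in forests *)

Section PermutationCycles.
Variable U : finType.
Implicit Types (e : rel U) (s : {perm U}).

(** Follow the cycle of s from l: its last vertex is sent to l, so it is k. Each earlier vertex is
    moved by s, hence along an edge. *)
Lemma perm_cycle_path e s k l :
  s k = l -> (forall i, i != k -> s i = i \/ e i (s i)) ->
  exists q, [/\ path e l q, uniq (l :: q), last l q = k & fpath s l q].
Proof.
move=> skl se; have sinj : injective s := @perm_inj _ s.
have := orbit_uniq s l; have := cycle_orbit sinj l; have := in_orbit s l.
case Eo : (orbit s l) => [|l' q] //.
have -> : l' = l by move: Eo; rewrite /orbit; case: (order s l) => //= m [].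
move=> _ cyc uq; exists q.
have /= := cyc; rewrite rcons_path => /andP[pq /eqP sl].
have lastk : last l q = k by apply: sinj; rewrite sl.
split=> //.
apply/(pathP l) => i iq; have /(pathP l)/(_ i iq)/eqP H := pq.
have inth : i < size (l :: q) by rewrite /= ltnS ltnW.
have nk : nth l (l :: q) i != k.
  rewrite -lastk (last_nth l) nth_uniq //=.
  by rewrite neq_ltn iq.
rewrite -H; case: (se _ nk) => [E|//].
have : nth l (l :: q) i == nth l (l :: q) i.+1 by rewrite /= -H E.
by rewrite nth_uniq //= => /eqP /n_Sn.
Qed.

End PermutationCycles.

(** Unlike in [simple_path], the empty path from a vertex to itself is allowed; it corresponds to
    the principal minors. *)
Definition upath (U : finType) (T : rel U) (x : U) (p : seq U) (y : U) : Prop :=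
  [/\ path T x p, uniq (x :: p) & last x p = y].

(* Sealed: comparing two of these sets by computation does not terminate in practice. *)
HB.lock Definition path_verts (U : finType) (T : rel U) (x y : U) : {set U} :=
  [set v | `[< exists2 p, upath T x p y & v \in x :: p >]].

Section Forests.
Variables (U : finType) (T : rel U).
Local Notation upath := (upath T).
Local Notation path_verts := (path_verts T).
Hypothesis Tsym : ssrbool.symmetric T.
Hypothesis Tirr : irreflexive T.
Hypothesis Tacyc : forall c : seq U, 2 < size c -> ~ ucycle T c.

(** Where two paths diverge, follow the first one until it meets the second again, at z. The two
    pieces up to z close to a cycle. *)
Lemma upath_unique x y p q : upath x p y -> upath x q y -> p = q.
Proof.
elim: p x q => [|a p IH] x [|b q] // [] Px Ux Lx [] Qx Vx Mx.
- by move: Vx; rewrite cons_uniq -{1}[x]/(last x [::]) Lx -Mx /= mem_last.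
- by move: Ux; rewrite cons_uniq -{1}[x]/(last x [::]) Mx -Lx /= mem_last.
have [ab|ab] := eqVneq a b.
  rewrite ab; congr (_ :: _); apply: (IH b).
    by split; [move: Px|move: Ux|move: Lx]; rewrite ab /= => // /andP[].
  by split; [move: Qx|move: Vx|exact: Mx] => /= /andP[].
have hasq : has (mem (b :: q)) (a :: p).
  apply/hasP; exists y; first by rewrite -Lx /= mem_last.
  by rewrite -Mx /= mem_last.
exfalso; have {}ab : head x (a :: p) != head x (b :: q) by [].
move: Px Ux ab.
case/split_find: hasq => z p1 p2 zq np1 Px Ux ab.
move: Qx Vx np1 ab; case/path.splitP: zq => q1 q2 Qx Vx np1 ab.
have {}Px : path T x (rcons p1 z) by move: Px; rewrite cat_path => /andP[].
have {}Qx : path T x (rcons q1 z) by move: Qx; rewrite cat_path => /andP[].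
(* The cycle has more than two vertices: if [p1] and [q1] were both empty, both paths would step
   from x to z. *)
apply: (@Tacyc (x :: rcons p1 z ++ rev q1)).
  rewrite /= size_cat size_rev size_rcons !addSn !ltnS addn_gt0.
  by case: p1 {np1 Px Ux} ab => [|//]; case: q1 {Qx Vx} => [|//] /=; rewrite eqxx.
rewrite /ucycle; apply/andP; split.
  rewrite /= rcons_cat cat_path Px last_rcons -rev_cons.
  have := rev_path T x (rcons q1 z); rewrite last_rcons belast_rcons => ->.
  by rewrite (eq_path (e' := T)) // => u v; rewrite Tsym.
move: Ux Vx; rewrite /= !mem_cat !cat_uniq !negb_or mem_rev rev_uniq.
move=> /andP[/andP[-> _] /and3P[-> _ _]] /andP[/andP[xq1 _] /and3P[uq1 _ _]].
move: xq1 uq1; rewrite mem_rcons inE negb_or rcons_uniq => /andP[_ ->] /andP[zq1 ->].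
rewrite /= andbT; apply/hasPn => u; rewrite mem_rev => uq1.
rewrite mem_rcons inE negb_or; apply/andP; split.
  by apply: contraNneq zq1 => <-.
apply: contra np1 => up1; apply/hasP; exists u => //.
by rewrite /= mem_cat mem_rcons inE uq1 !orbT.
Qed.

Lemma connect_upath x y : connect T x y -> exists p, upath x p y.
Proof.
case/connectP=> p pT ->; case/shortenP: pT => p' p'T Up' _.
by exists p'; split.
Qed.

Lemma upath_connect x p y : upath x p y -> connect T x y.
Proof. by move=> [px _ <-]; apply/connectP; exists p. Qed.

Lemma upath_rev x p y : upath x p y ->
  exists2 q, upath y q x & x :: p =i y :: q.
Proof.
move=> [px up lp]; exists (rev (belast x p)); last first.
  by move=> u; rewrite lastI lp mem_rcons !inE mem_rev.
have E : rev (x :: p) = y :: rev (belast x p) by rewrite lastI lp rev_rcons.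
split; [|by rewrite -E rev_uniq|].
  rewrite -lp rev_path (eq_path (e' := T)) // => u v; exact: Tsym.
by case: (p) E => [|a p'] E /=; [case: E|rewrite rev_cons last_rcons].
Qed.

Lemma path_vertsE x p y : upath x p y -> path_verts x y =i x :: p.
Proof.
move=> up v; rewrite path_verts.unlock inE; apply/asboolP/idP => [[q uq]|vp]; last by exists p.
by rewrite (upath_unique uq up).
Qed.

Lemma card_path_verts x p y : upath x p y -> #|path_verts x y| = (size p).+1.
Proof.
move=> up; rewrite (eq_card (path_vertsE up)); case: up => _ up _.
by rewrite (card_uniqP up).
Qed.

Lemma path_verts_refl x : path_verts x x = [set x].
Proof.
apply/setP => v; have up : upath x [::] x by [].
by rewrite (path_vertsE up) !inE.
Qed.

Lemma path_verts_sym x y : path_verts x y = path_verts y x.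
Proof.
by apply/setP => v; rewrite path_verts.unlock !inE; apply/asboolP/asboolP;
  move=> [p /upath_rev[q uq E]]; rewrite E; exists q.
Qed.

Lemma path_verts_ends x y : connect T x y ->
  x \in path_verts x y /\ y \in path_verts x y.
Proof.
case/connect_upath=> p up; rewrite !(path_vertsE up) mem_head.
by case: up => _ _ <-; rewrite mem_last.
Qed.

Lemma upath_prefix x p q y : upath x (p ++ q) y -> upath x p (last x p).
Proof.
case; rewrite cat_path -cat_cons cat_uniq => /andP[px _] /andP[up _] _.
by split.
Qed.

(** Otherwise the edge from x to v would be a second path beside the initial piece of the given
    one. *)
Lemma upath_neighbour x b p y v : upath x (b :: p) y -> v \in b :: p -> T x v -> v = b.
Proof.
move=> up vp Txv; case/splitPl: vp up => s1 s2 ls1.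
rewrite -cat_cons => /upath_prefix /=; rewrite ls1 => u1.
have u2 : upath x [:: v] v.
  by split; rewrite //= ?Txv // inE andbT; apply: contraTneq Txv => ->; rewrite Tirr.
by case: (upath_unique u1 u2).
Qed.

Lemma path_verts_neighbour x j y v : connect T j y -> T x j ->
  x \notin path_verts j y -> v \in path_verts j y -> T x v -> v = j.
Proof.
move=> /connect_upath[p up] Txj; rewrite !(path_vertsE up) => xp vp.
apply: (@upath_neighbour _ _ p y) vp.
by case: up => pj uj lj; split; rewrite //= ?Txj // xp.
Qed.

(** If x lies on the path from j to y, it must be its second vertex, and dropping j gives the path
    from x. *)
Lemma path_verts_step x j y : connect T x y -> T x j ->
  (x \notin path_verts j y /\ path_verts x y = x |: path_verts j y) \/
  (j \notin path_verts x y /\ path_verts j y = j |: path_verts x y).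
Proof.
move=> cxy Txj; have /connect_upath[p up] : connect T j y.
  by apply: connect_trans cxy; apply: connect1; rewrite Tsym.
case: (boolP (x \in j :: p)) => xp; last first.
  left; have ux : upath x (j :: p) y.
    by case: up => pj uj lj; split; rewrite //= ?Txj // xp.
  rewrite (path_vertsE up) xp; split=> //; apply/setP => v.
  by rewrite (path_vertsE ux) in_setU1 (path_vertsE up) inE.
right; case: p up xp => [|b p] up xp.
  by move: xp Txj; rewrite inE => /eqP ->; rewrite Tirr.
have xj : x != j by apply: contraTneq Txj => ->; rewrite Tirr.
have xb : x = b.
  by apply: (upath_neighbour up) => //; [move: xp; rewrite inE (negPf xj)|rewrite Tsym].
have ux : upath x p y by case: up; rewrite xb /= => /andP[_ ?] /andP[_ ?] ?; split.
split; first by rewrite (path_vertsE ux) xb; case: up => _ /andP[].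
by apply/setP => v; rewrite (path_vertsE up) in_setU1 (path_vertsE ux) xb inE.
Qed.

Lemma path_verts_first x y : connect T x y -> x != y -> exists j,
  [/\ T x j, connect T j y, x \notin path_verts j y
    & path_verts x y = x |: path_verts j y].
Proof.
case/connect_upath=> -[|j p] up xy; first by case: up xy => _ _ /= ->; rewrite eqxx.
have uj : upath j p y by case: up => /= /andP[_ ?] /andP[_ ?] ?; split.
exists j; split; [by case: up => /andP[]|exact: upath_connect uj| |].
  by rewrite (path_vertsE uj); case: up => _ /andP[].
by apply/setP => v; rewrite (path_vertsE up) in_setU1 (path_vertsE uj) inE.
Qed.

Lemma upath_sub_ends x p y a q b c1 c2 :
  upath x p y -> x :: p = c1 ++ a :: q ++ c2 -> b = last a q ->
  #|path_verts x y| <= #|path_verts a b| -> a = x /\ b = y.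
Proof.
move=> up E Eb; have uq : upath a q b.
  case: up => px ux _; have : sorted T (c1 ++ a :: q ++ c2) by rewrite -E.
  move/cat_sorted2 => -[_] /=; rewrite cat_path => /andP[pq _].
  split=> //; first by move: ux; rewrite E cat_uniq -cat_cons cat_uniq => /and3P[_ _ /and3P[]].
rewrite (card_path_verts up) (card_path_verts uq) -[(size p).+1]/(size (x :: p)) E.
rewrite size_cat /= size_cat addnS ltnS addnCA -[X in _ <= X]addn0 leq_add2l.
rewrite leqn0 addn_eq0 !size_eq0 => /andP[/eqP c10 /eqP c20].
by move: E up; rewrite c10 c20 cats0 => -[-> ->] [_ _ <-].
Qed.

(** The path between a and b is a segment of the one between x and y, so having at least as many
    vertices it is all of it. This makes reduced pairs unique up to order. *)
Lemma path_verts_inj x y a b : connect T x y -> connect T a b ->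
  a \in path_verts x y -> b \in path_verts x y ->
  #|path_verts x y| <= #|path_verts a b| -> (a = x /\ b = y) \/ (a = y /\ b = x).
Proof.
move=> /connect_upath[p up] cab; rewrite !(path_vertsE up) => ap bp le.
pose ordered c d := exists c1 q c2, x :: p = c1 ++ c :: q ++ c2 /\ d = last c q.
have [[c1 [q [c2 [E Eb]]]]|[c1 [q [c2 [E Eb]]]]] : ordered a b \/ ordered b a.
- have Ea := cat_take_drop (index a (x :: p)) (x :: p).
  rewrite (drop_nth x) ?index_mem // nth_index // in Ea.
  set c1 := take _ _ in Ea; set c2 := drop _ _ in Ea.
  move: bp; rewrite -Ea mem_cat => /orP[b1|b2].
    right; case/splitPr: b1 Ea => d1 d2 Ea.
    exists d1, (rcons d2 a), c2; rewrite last_rcons; split=> //.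
    by rewrite -Ea cat_rcons -catA.
  left; case/splitPl: b2 Ea => d1 d2 Eb Ea; exists c1, d1, d2.
  by rewrite Ea Eb.
- by left; apply: (upath_sub_ends up E Eb le).
- rewrite [path_verts a b]path_verts_sym in le.
  by right; have [-> ->] := upath_sub_ends up E Eb le.
Qed.

End Forests.

Section SpanningForests.
Variables (n : nat) (G T : rel 'I_n).
Hypotheses (hG : simple_graph G) (hT : spanning_forest G T).

Lemma spanning_forest_sub x y : T x y -> G x y.
Proof.
have [t [tree TE]] := hT; rewrite TE => /existsP[C /andP[/tree[_ tC _ _] /tC[]]].
by [].
Qed.

Lemma spanning_forest_sym : ssrbool.symmetric T.
Proof.
have [t [tree TE]] := hT; move=> x y; rewrite !TE; apply: eq_existsb => C.
by case: (boolP (C \in _)) => //= /tree[[tsym _] _ _ _]; rewrite tsym.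
Qed.

Lemma spanning_forest_irr : irreflexive T.
Proof.
move=> x; apply/negP => /spanning_forest_sub; case: hG => _ Girr.
by rewrite Girr.
Qed.

Lemma spanning_forest_connect x y : connect T x y = connect G x y.
Proof.
have [t [tree TE]] := hT; apply/idP/idP.
  apply: connect_sub => {}x {}y /spanning_forest_sub; exact: connect1.
move=> cxy; set C := [set z | connect G x z].
have Ccomp : C \in components G by apply/imsetP; exists x.
have [_ _ tconn _] := tree C Ccomp.
have := tconn x y; rewrite !inE connect0 cxy => /(_ isT isT).
apply: connect_sub => u v tuv; apply: connect1; rewrite TE.
by apply/existsP; exists C; rewrite Ccomp.
Qed.

(** A cycle stays in one component, so all its edges belong to the tree of that component. *)
Lemma spanning_forest_acyclic (c : seq 'I_n) : 2 < size c -> ~ ucycle T c.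
Proof.
have [t [tree TE]] := hT; have [Gsym _] := hG.
case: c => // x c sc; rewrite /ucycle => /andP[cyc uc].
set C := [set z | connect G x z].
have Ccomp : C \in components G by apply/imsetP; exists x.
have [_ tsub _ tacyc] := tree C Ccomp; apply: (tacyc _ sc).
rewrite /ucycle uc andbT; move: cyc; rewrite /cycle.
suff walk s z : z \in C -> path T z s -> path (t C) z s.
  by apply: walk; rewrite inE.
elim: s z => //= w s IH z zC /andP[Tzw /IH].
have : t C z w.
  move: Tzw; rewrite TE => /existsP[D /andP[Dc tDzw]].
  have [_ /(_ _ _ tDzw)[zD _ _] _ _] := tree D Dc.
  suff <- : D = C by [].
  case/imsetP: Dc zD => d _ ->; rewrite inE => dz; apply/setP => v; rewrite !inE.
  move: zC; rewrite inE => xz.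
  have Gcs := sym_connect_sym Gsym.
  by rewrite (same_connect Gcs dz) (same_connect Gcs xz).
move=> tzw; rewrite tzw; apply.
by have [_ /(_ _ _ tzw)[]] := tree C Ccomp.
Qed.

End SpanningForests.

(** * Variables of the symmetric matrix and weight orders *)

Section SymmetricVariables.
Variable n : nat.
Implicit Types (i j k l : 'I_n) (v : 'I_(nvars n)) (H : rel 'I_n) (V : {set 'I_n}).

Lemma var_fstE i j : var_fst (var_idx i j) = (sort_pair i j).1.
Proof. by rewrite /var_fst /var_idx enum_rankK. Qed.

Lemma var_sndE i j : var_snd (var_idx i j) = (sort_pair i j).2.
Proof. by rewrite /var_snd /var_idx enum_rankK. Qed.

Lemma sort_pairC i j : sort_pair i j = sort_pair j i.
Proof.
rewrite /sort_pair; case: (ltngtP i j) => // /ord_inj ->; by [].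
Qed.

Lemma var_idxC i j : var_idx i j = var_idx j i.
Proof. by congr enum_rank; apply: val_inj; apply: sort_pairC. Qed.

Lemma var_idx_surj v : v = var_idx (var_fst v) (var_snd v).
Proof.
rewrite /var_idx /var_fst /var_snd -[LHS]enum_valK; congr enum_rank.
by apply: val_inj; case: (enum_val v) => -[i j] /= ij; rewrite /sort_pair ij.
Qed.

Lemma var_idx_eq i j k l : (var_idx i j == var_idx k l) =
  ((i == k) && (j == l)) || ((i == l) && (j == k)).
Proof.
rewrite (inj_eq enum_rank_inj) -val_eqE /= /sort_pair.
apply/eqP/idP => [|/orP[]/andP[/eqP -> /eqP ->] //]; last exact: sort_pairC.
by case: ifP => _; case: ifP => _ [-> ->]; rewrite !eqxx ?orbT.
Qed.

Lemma var_sym_rel (r : 'I_n -> 'I_n -> bool) i j : (forall i j, r i j = r j i) ->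
  r (var_fst (var_idx i j)) (var_snd (var_idx i j)) = r i j.
Proof.
by move=> rsym; rewrite var_fstE var_sndE /sort_pair; case: ifP.
Qed.

Lemma weight_var H i j : ssrbool.symmetric H ->
  weight H (var_idx i j) = if (i == j) || H i j then 2 else 1.
Proof.
move=> Hsym; rewrite /weight.
rewrite (var_sym_rel (r := fun i j => (i == j) || H i j)) // => k l.
by rewrite eq_sym Hsym.
Qed.

Lemma in_Z_var H i j : ssrbool.symmetric H ->
  in_Z H (var_idx i j) = (i != j) && ~~ H i j.
Proof.
move=> Hsym; rewrite /in_Z var_fstE var_sndE /sort_pair; case: (ltngtP i j) => /= ij.
- by rewrite ij -val_eqE /= neq_ltn ij.
- by rewrite ij -val_eqE /= neq_ltn ij orbT Hsym.
- by rewrite ij ltnn -val_eqE /= ij eqxx.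
Qed.

Lemma wdegD H m m' : wdeg H (m + m') = wdeg H m + wdeg H m'.
Proof.
by rewrite /wdeg -big_split; apply: eq_bigr => v _; rewrite mnmDE mulnDl.
Qed.

Lemma wdegU H v : wdeg H U_(v) = weight H v.
Proof.
rewrite /wdeg (bigD1 v) //= mnm1E eqxx mul1n big1 ?addn0 // => w wv.
by rewrite mnm1E eq_sym (negPf wv).
Qed.

Lemma wdeg0 H : wdeg H 0 = 0.
Proof. by rewrite /wdeg big1 // => v _; rewrite mnm0E. Qed.

Lemma wdeg_sum H (I : Type) (r : seq I) (P : pred I) (F : I -> 'X_{1..nvars n}) :
  wdeg H (\sum_(i <- r | P i) F i)%MM = \sum_(i <- r | P i) wdeg H (F i).
Proof. by apply: (big_morph (wdeg H)); [exact: wdegD|exact: wdeg0]. Qed.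

End SymmetricVariables.

Section WeightOrder.
Variables (n : nat) (T G : rel 'I_n).
Local Notation lt := (lt_TG T G).
Implicit Types m a b c : 'X_{1..nvars n}.

Lemma lt_TGP a b : reflect
  (wdeg G a < wdeg G b \/ (wdeg G a = wdeg G b /\ (wdeg T a < wdeg T b \/
    (wdeg T a = wdeg T b /\ wdeg (@no_edges n) a < wdeg (@no_edges n) b))))
  (lt a b).
Proof.
apply: (iffP orP) => -[|]; [by left| |by left|].
  by case/andP=> /eqP e /orP[|/andP[/eqP]]; right; split=> //; [left|right].
case=> e [|[e' ?]]; right; rewrite e eqxx /=; apply/orP; first by left.
by right; rewrite e' eqxx.
Qed.

Lemma lt_TG_irr : irreflexive lt.
Proof. by move=> a; rewrite /lt_TG !ltnn !andbF. Qed.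

Lemma lt_TG_trans : transitive lt.
Proof. by move=> b a c /lt_TGP ab /lt_TGP bc; apply/lt_TGP; lia. Qed.

Lemma lt_TG_weak a b c : lt a c -> lt a b || lt b c.
Proof.
move=> /lt_TGP ac; apply/orP.
case: (boolP (lt a b)) => [|/lt_TGP nab]; [by left|right].
by apply/lt_TGP; lia.
Qed.

Lemma lt_TG_add2r a b c : lt (a + c)%MM (b + c)%MM = lt a b.
Proof. by rewrite /lt_TG !wdegD !ltn_add2r !eqn_add2r. Qed.

(** The order compares three natural numbers lexicographically, whence three nested strong
    inductions. *)
Lemma lt_TG_ind (P : 'X_{1..nvars n} -> Prop) :
  (forall u, (forall t, lt t u -> P t) -> P u) -> forall u, P u.
Proof.
move=> IH u.
elim/ltn_ind: {u}(wdeg G u) {-2}u (erefl (wdeg G u)) => g IHg u.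
elim/ltn_ind: {u}(wdeg T u) {-2}u (erefl (wdeg T u)) => t IHt u.
elim/ltn_ind: {u}(wdeg (@no_edges n) u) {-2}u (erefl (wdeg (@no_edges n) u)).
move=> d IHd u ud ut ug; apply: IH => v /lt_TGP[|[eg [|[et]]]].
- by rewrite ug => /IHg; apply.
- by rewrite ut => /IHt; apply=> //; rewrite eg.
- by rewrite ud => /IHd; apply=> //; rewrite ?et ?eg.
Qed.

End WeightOrder.

(** * Path monomials and their weights *)

Section PathMonomials.
Variables (n : nat) (G T : rel 'I_n).
Hypothesis Gsym : ssrbool.symmetric G.
Hypothesis Tsym : ssrbool.symmetric T.
Hypothesis Tirr : irreflexive T.
Hypothesis Tacyc : forall c : seq 'I_n, 2 < size c -> ~ ucycle T c.
Hypothesis TG : forall x y, T x y -> G x y.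
Hypothesis TGconn : forall x y, connect T x y = connect G x y.
Implicit Types (i j k l : 'I_n) (V : {set 'I_n}).

Local Notation "'U2_ ( i , j )" := (U_(var_idx i j))%MM
  (at level 8, i, j at level 200, format "''U2_' ( i ,  j )").
Local Notation pv := (path_verts T).

(** The diagonal variables off V times the edges of [T] inside V. A path in a forest has no chords,
    so for the vertex set of a path this is the path generator of [I_T]; for a single vertex it is a
    diagonal generator. *)
Definition pmon V : 'X_{1..nvars n} :=
  [multinom (if var_fst v == var_snd v then var_fst v \notin V
     else [&& T (var_fst v) (var_snd v), var_fst v \in V & var_snd v \in V]) : nat
   | v < nvars n].

Lemma pmonE V i j : pmon V (var_idx i j) =
  (if i == j then i \notin V else [&& T i j, i \in V & j \in V]) :> nat.
Proof.
rewrite mnmE; congr nat_of_bool.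
apply: (@var_sym_rel n (fun i j => if i == j then i \notin V else [&& T i j, i \in V & j \in V])).
by move=> {}i {}j; rewrite eq_sym Tsym [(i \in V) && _]andbC; case: eqP => // ->.
Qed.

(** Adding k removes the diagonal variable of k and brings in exactly one edge, since j is its only
    neighbour in V. *)
Lemma pmon_step V k j : T k j -> k \notin V -> j \in V ->
  (forall v, v \in V -> T k v -> v = j) ->
  (pmon (k |: V) + 'U2_(k, k) = pmon V + 'U2_(k, j))%MM.
Proof.
move=> Tkj kV jV nb; apply/mnmP => v; rewrite [v]var_idx_surj.
move: (var_fst v) (var_snd v) => a b {v}; rewrite !mnmDE !mnm1E !pmonE !var_idx_eq.
have kj : k != j by apply: contraTneq kV => ->; rewrite jV.
rewrite !in_setU1 ![k == _]eq_sym ![j == _]eq_sym.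
have [<-|ab] := eqVneq a b.
  by have [->|ak] := eqVneq a k; rewrite ?(negPf kV) ?(negPf kj) //= ?andbF ?addn0.
have [ak|ak] := eqVneq a k.
  rewrite ak in ab *; rewrite (negPf kV) (negPf kj) [b == k]eq_sym (negPf ab) /= andbF !addn0 orbF.
  congr nat_of_bool; have [->|bj] := eqVneq b j; first by rewrite Tkj jV.
  by apply/negP => /andP[Tkb bV]; rewrite (nb b bV Tkb) eqxx in bj.
have [bk|bk] := eqVneq b k; last by [].
rewrite bk (negPf kV) /= !andbF /= andbT addn0.
congr nat_of_bool; rewrite Tsym; have [->|bj] := eqVneq a j; first by rewrite Tkj jV.
by apply/negP => /andP[Tkb bV]; rewrite (nb a bV Tkb) eqxx in bj.
Qed.

Lemma pmon_set1 k : pmon [set k] = (\sum_(i | i != k) 'U2_(i, i))%MM.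
Proof.
apply/mnmP => v; rewrite [v]var_idx_surj mnm_sumE.
move: (var_fst v) (var_snd v) => a b {v}; rewrite pmonE.
have [<-|ab] := eqVneq a b; last first.
  rewrite big1 => [|i _]; last first.
    rewrite mnm1E var_idx_eq; have [->|ai] := eqVneq i a; last by rewrite andbF.
    by rewrite (negPf ab).
  rewrite !inE; have [<-|] := eqVneq a k; last by rewrite andbF.
  by rewrite [b == a]eq_sym (negPf ab) !andbF.
rewrite inE; case: (boolP (a == k)) => ak /=.
  rewrite big1 // => i ik; rewrite mnm1E var_idx_eq -(eqP ak) in ik *.
  by rewrite (negPf ik).
rewrite (bigD1 a) //= mnm1E eqxx big1 ?addn0 // => i /andP[_ ia].
by rewrite mnm1E var_idx_eq (negPf ia).
Qed.

Lemma pmon_first k j l : T k j -> connect T j l -> k \notin pv j l ->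
  pv k l = k |: pv j l ->
  (pmon (pv k l) + 'U2_(k, k) = pmon (pv j l) + 'U2_(k, j))%MM.
Proof.
move=> Tkj cjl kV ->; apply: pmon_step => //.
  by have [] := path_verts_ends Tsym Tacyc cjl.
by move=> v vV; apply: (path_verts_neighbour Tsym Tirr Tacyc cjl).
Qed.

Lemma pmon_path k p l : upath T k p l -> pmon (pv k l) =
  (\sum_(i | i \notin k :: p) 'U2_(i, i) + \sum_(e <- zip (k :: p) p) 'U2_(e.1, e.2))%MM.
Proof.
elim: p k => [|j p IH] k up.
  have <- : k = l by case: up.
  rewrite (path_verts_refl Tsym Tacyc) pmon_set1 big_nil addm0.
  by apply: eq_bigl => i; rewrite inE.
have uj : upath T j p l by case: up => /= /andP[_ ?] /andP[_ ?] ?; split.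
have [Tkj kp] : T k j /\ k \notin j :: p by case: up => /= /andP[-> _] /andP[].
have cjl := upath_connect uj.
have kV : k \notin pv j l by rewrite (path_vertsE Tsym Tacyc uj).
have VE : pv k l = k |: pv j l.
  by apply/setP => v; rewrite in_setU1 !(path_vertsE Tsym Tacyc up, path_vertsE Tsym Tacyc uj) inE.
apply: (@addIm _ 'U2_(k, k)); rewrite (pmon_first Tkj cjl kV VE) (IH j uj) /= big_cons /=.
have -> : (\sum_(i | i \notin j :: p) 'U2_(i, i) =
    'U2_(k, k) + \sum_(i | i \notin [:: k, j & p]) 'U2_(i, i))%MM.
  rewrite (bigD1 k) //=; congr (_ + _)%MM; apply: eq_bigl => i.
  by rewrite [i \in [:: k, j & p]]in_cons negb_or andbC.
by rewrite [RHS]addmC -!addmA [('U2_(k, j) + _)%MM]addmC.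
Qed.

Lemma path_zip (e : rel 'I_n) x p : path e x p = all (fun ab => e ab.1 ab.2) (zip (x :: p) p).
Proof. by elim: p x => //= a p IH x; rewrite IH. Qed.

Lemma card_notin_uniq (s : seq 'I_n) : uniq s -> #|(fun i : 'I_n => i \notin s)| + size s = n.
Proof.
move=> us; rewrite -(card_uniqP us) addnC -[RHS]card_ord -(cardC (mem s)).
by congr (_ + _); apply: eq_card => i; rewrite !inE.
Qed.

(** The n - 1 factors are diagonal variables and edges of [T], each of weight 2. Hence the first two
    weights, for [G] and [T], do not distinguish path monomials. *)
Lemma wdeg_pmon (H : rel 'I_n) k l : ssrbool.symmetric H ->
  (forall x y, T x y -> H x y) -> connect T k l -> wdeg H (pmon (pv k l)) = 2 * n.-1.
Proof.
move=> Hsym TH /(connect_upath)[p up]; rewrite (pmon_path up) wdegD !wdeg_sum.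
rewrite (eq_bigr (fun=> 2)) => [|i _]; last by rewrite wdegU weight_var // eqxx.
have [pT ukp _] := up; have /allP eT : all (fun ab => T ab.1 ab.2) (zip (k :: p) p).
  by rewrite -path_zip.
rewrite [X in _ + X](eq_big_seq (fun=> 2)) => [|e /eT/TH eH]; last first.
  by rewrite wdegU weight_var // eH orbT.
rewrite sum_nat_const big_const_seq count_predT iter_addn_0 size_zip /=.
have := card_notin_uniq ukp; rewrite /= (minn_idPr (leqnSn _)).
move: #|_| => c; lia.
Qed.

Lemma mdeg_pmon k l : connect T k l -> mdeg (pmon (pv k l)) = n.-1.
Proof.
move=> /(connect_upath)[p up]; rewrite (pmon_path up) mdegD !mdeg_sum.
rewrite (eq_bigr (fun=> 1)) => [|i _]; last by rewrite mdeg1.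
rewrite [X in _ + X](eq_bigr (fun=> 1)) => [|i _]; last by rewrite mdeg1.
have [_ ukp _] := up; have := card_notin_uniq ukp.
rewrite !sum_nat_const big_const_seq count_predT iter_addn_0 size_zip /=.
rewrite (minn_idPr (leqnSn _)); move: #|_| => c; lia.
Qed.

(** Here u and t are the leading monomials of the terms j = k and j of the adjugate relation in row
    k, column l. If kj is not in [T], the [T]-weight of t is smaller; if j lengthens the path, the
    diagonal weight is smaller. Only the next vertex on the path to l gives t = u. *)
Lemma relation_term_lt k j l : connect T k l -> G k j || (k == j) -> connect T j l ->
  let u := (pmon (pv k l) + 'U2_(k, k))%MM in
  let t := (pmon (pv j l) + 'U2_(k, j))%MM in
  [\/ j = k, [/\ T k j, t = u, k \notin pv j l & pv k l = k |: pv j l] | lt_TG T G t u].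
Proof.
move=> ckl Gkj cjl u t; have [->|kj] := eqVneq j k; first by apply: Or31.
rewrite eq_sym (negPf kj) orbF in Gkj.
have wG m i h : wdeg G (m + 'U2_(i, h)) = wdeg G m + (if (i == h) || G i h then 2 else 1).
  by rewrite wdegD wdegU weight_var.
have wT m i h : wdeg T (m + 'U2_(i, h)) = wdeg T m + (if (i == h) || T i h then 2 else 1).
  by rewrite wdegD wdegU weight_var.
have wD m i h : wdeg (@no_edges n) (m + 'U2_(i, h)) = wdeg (@no_edges n) m + (if i == h then 2 else 1).
  by rewrite wdegD wdegU weight_var // orbF.
have wGk := wdeg_pmon Gsym TG ckl; have wGj := wdeg_pmon Gsym TG cjl.
have wTk := wdeg_pmon Tsym (fun _ _ h => h) ckl.
have wTj := wdeg_pmon Tsym (fun _ _ h => h) cjl.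
have eGu : wdeg G u = wdeg G t by rewrite wG eqxx wGk wG Gkj orbT wGj.
have uT : wdeg T u = 2 * n.-1 + 2 by rewrite wT eqxx wTk.
have tT : wdeg T t = 2 * n.-1 + (if T k j then 2 else 1).
  by rewrite wT wTj eq_sym (negPf kj).
case: (boolP (T k j)) => Tkj; last first.
  apply: Or33; apply/lt_TGP; right; split; first exact: esym.
  by left; rewrite tT uT (negPf Tkj) ltn_add2l.
have [[kV VE]|[jV VE]] := path_verts_step Tsym Tirr Tacyc ckl Tkj.
  by apply: Or32; split; [|exact: esym (pmon_first Tkj cjl kV VE)| |].
have Tjk : T j k by rewrite Tsym.
have := congr1 (wdeg (@no_edges n)) (pmon_first Tjk ckl jV VE).
rewrite !wD eqxx (negPf kj) => E.
apply: Or33; apply/lt_TGP; right; split; first exact: esym.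
right; split; first by rewrite uT tT Tkj.
rewrite !wD eqxx eq_sym (negPf kj).
move: E; move: (wdeg (@no_edges n) (pmon (pv j l))) (wdeg (@no_edges n) (pmon (pv k l))).
clear; lia.
Qed.

End PathMonomials.

(** * The adjugate of the sparse symmetric matrix *)

Section FunctionPaths.
Variables (U : finType) (s : U -> U).

Lemma fpath_zip (A : Type) (idx : A) (op : Monoid.law idx) (F : U -> U -> A) x q :
  fpath s x q -> \big[op/idx]_(e <- zip (x :: q) q) F e.1 e.2 =
    \big[op/idx]_(i <- belast x q) F i (s i).
Proof.
elim: q x => [|y q IH] x /=; first by rewrite !big_nil.
by case/andP=> /eqP <- /IH E; rewrite !big_cons E.
Qed.

Lemma fpath_rel (e : rel U) x q : fpath s x q -> path e x q ->
  forall i, i \in belast x q -> e i (s i).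
Proof.
elim: q x => [|y q IH] x //= /andP[/eqP <- sq] /andP[ex eq] i.
by rewrite inE => /orP[/eqP -> //|]; apply: IH.
Qed.

End FunctionPaths.

(* Sealed, like [path_verts], to keep conversion tests from expanding determinants. *)
HB.lock Definition sparse_cofactor (K : fieldType) (n : nat) (G : rel 'I_n)
    (k l : 'I_n) : {mpoly K[nvars n]} := cofactor (X_of K G) k l.

Section Cofactors.
Local Open Scope ring_scope.
Variables (K : fieldType) (n : nat) (G T : rel 'I_n).
Hypothesis Gsym : ssrbool.symmetric G.
Hypothesis Tsym : ssrbool.symmetric T.
Hypothesis Tirr : irreflexive T.
Hypothesis Tacyc : forall c : seq 'I_n, (2 < size c)%N -> ~ ucycle T c.
Hypothesis TG : forall x y, T x y -> G x y.
Hypothesis TGconn : forall x y, connect T x y = connect G x y.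
Implicit Types (i j k l : 'I_n) (s : {perm 'I_n}).
Local Notation "'U2_ ( i , j )" := (U_(var_idx i j))%MM
  (at level 8, i, j at level 200, format "''U2_' ( i ,  j )").
Local Notation pv := (path_verts T).
Local Notation pmon := (pmon T).
Local Notation X := (X_of K G).
Local Notation A := (sparse_cofactor K G).

Lemma subst_Z_var i j :
  subst_Z G (x_ K i j) = if (i == j) || G i j then x_ K i j else 0.
Proof.
rewrite /subst_Z /x_ comp_mpolyXU -tnth_nth tnth_mktuple in_Z_var //.
by case: eqP => //= _; case: (G i j).
Qed.

Lemma X_ofE i j : X i j = if (i == j) || G i j then x_ K i j else 0.
Proof. by rewrite !mxE subst_Z_var. Qed.

Lemma X_of_tr : X^T = X.
Proof.
apply/matrixP => i j; rewrite mxE !X_ofE /x_ var_idxC eq_sym Gsym; by [].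
Qed.

Lemma cofactor_sym k l : A k l = A l k.
Proof.
rewrite !sparse_cofactor.unlock.
by have := trmx_adj X; rewrite X_of_tr => /matrixP/(_ k l); rewrite !mxE.
Qed.

Definition perm_mon (k : 'I_n) s : 'X_{1..nvars n} :=
  (\sum_(i | i != k) 'U2_(i, s i))%MM.

(** The term of s survives the substitution of 0 for the variables in Z; row k is absent from the
    cofactor. *)
Definition perm_in (k : 'I_n) s := [forall i, (i != k) ==> (i == s i) || G i (s i)].

Lemma prod_X_of k s :
  \prod_(i | k != i) X i (s i) = if perm_in k s then 'X_[perm_mon k s] else 0.
Proof.
rewrite (eq_bigl (fun i => i != k)) => [|i]; last by rewrite eq_sym.
case: ifP => [/forallP sG|/negbT]; last first.
  rewrite negb_forall => /existsP[i]; rewrite negb_imply => /andP[ik /negPf nG].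
  by rewrite (bigD1 i) //= X_ofE nG mul0r.
rewrite /perm_mon -mprodXE; apply: eq_bigr => i ik; rewrite X_ofE.
by have := sG i; rewrite ik /= => ->.
Qed.

Lemma cofactorE k l : A k l =
  \sum_(s : {perm 'I_n} | (s k == l) && perm_in k s) (-1) ^+ s *: 'X_[perm_mon k s].
Proof.
rewrite sparse_cofactor.unlock expand_cofactor big_mkcondr; apply: eq_bigr => s _.
rewrite prod_X_of; case: ifP => _; last by rewrite mulr0.
by rewrite -mul_mpolyC rmorphXn rmorphN rmorph1.
Qed.

(** The cycle through l of a permutation with nonzero term would give a path in [G] from l to k. *)
Lemma cofactor_eq0 k l : ~~ connect T k l -> A k l = 0.
Proof.
move=> nkl; rewrite cofactorE big_pred0 // => s; apply/negP => /andP[/eqP skl /forallP sG].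
have sG' i : i != k -> s i = i \/ G i (s i).
  by move=> ik; have := sG i; rewrite ik /= => /orP[/eqP e|]; [left|right].
have [q [pq _ lq _]] := perm_cycle_path skl sG'.
case/negP: nkl; rewrite TGconn (sym_connect_sym Gsym); apply/connectP.
by exists q.
Qed.

Lemma sum_const_neq k c : (\sum_(i < n | i != k) c = c * n.-1)%N.
Proof.
rewrite sum_nat_const mulnC; congr (_ * _)%N.
by rewrite -[n in RHS]card_ord -(cardC1 k); apply: eq_card.
Qed.

Lemma mdeg_perm_mon k s : mdeg (perm_mon k s) = n.-1.
Proof.
rewrite /perm_mon mdeg_sum (eq_bigr (fun=> 1%N)) => [|i _]; last by rewrite mdeg1.
by rewrite sum_const_neq mul1n.
Qed.

Lemma wdeg_perm_mon (H : rel 'I_n) k s : ssrbool.symmetric H ->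
  wdeg H (perm_mon k s) = (\sum_(i | i != k) if (i == s i) || H i (s i) then 2 else 1)%N.
Proof.
move=> Hsym; rewrite /perm_mon wdeg_sum; apply: eq_bigr => i _.
by rewrite wdegU weight_var.
Qed.

Lemma perm_mon_path k l q s : upath T l q k -> fpath s l q ->
  (forall i, i \notin l :: q -> s i = i) -> perm_mon k s = pmon (pv l k).
Proof.
move=> up sq sfix; rewrite (pmon_path Tsym Tirr Tacyc up) /perm_mon.
have [_ uq lq] := up; have E := lastI l q; rewrite lq in E.
have [kb ub] : k \notin belast l q /\ uniq (belast l q).
  by move: uq; rewrite E rcons_uniq => /andP.
rewrite (fpath_zip _ (fun i j => 'U2_(i, j)) sq) (bigID (fun i => i \in l :: q)) /=.
rewrite [LHS]addmC; congr (_ + _)%MM.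
  apply: eq_big => [i|i /andP[_ iq]]; last by rewrite sfix.
  rewrite andbC; case: (boolP (i \in l :: q)) => //= iq.
  by apply: contraNneq iq => ->; rewrite E mem_rcons mem_head.
rewrite big_uniq //=; apply: eq_bigl => i; rewrite E mem_rcons inE.
by have [->|ik] /= := eqVneq i k; rewrite ?(negPf kb).
Qed.

Lemma ltn_sum_one (P : pred 'I_n) (F F' : 'I_n -> nat) i :
  P i -> (F i < F' i)%N -> (forall j, P j -> (F j <= F' j)%N) ->
  (\sum_(j | P j) F j < \sum_(j | P j) F' j)%N.
Proof.
move=> Pi lti le; rewrite (bigD1 i) //= [X in (_ < X)%N](bigD1 i) //= -addSn leq_add //.
by apply: leq_sum => j /andP[/le].
Qed.

(** All surviving terms have the same [G]-weight. A term using an entry outside [T] loses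
    [T]-weight. Any other term follows the unique path on its cycle through l, and loses diagonal
    weight by moving a vertex off the path. *)
Lemma perm_mon_lead k l : connect T k l -> exists s0 : {perm 'I_n},
  [/\ s0 k == l, perm_in k s0, perm_mon k s0 = pmon (pv k l)
    & forall s, s k == l -> perm_in k s -> s != s0 ->
        lt_TG T G (perm_mon k s) (pmon (pv k l))].
Proof.
move=> ckl; have clk : connect T l k by rewrite (sym_connect_sym Tsym).
have [q up] := connect_upath clk; have [pq uq lq] := up.
(* [s0] rotates the path from l to k, closing up with k to l, and fixes all other vertices. *)
pose s0 := perm (can_inj (prev_next uq)).
have s0E i : s0 i = next (l :: q) i by rewrite permE.
have cyc0 : fcycle s0 (l :: q).
  have := cycle_next uq; congr (_ : bool); apply: eq_cycle => i j /=.
  by rewrite s0E.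
have /andP[sq0 /eqP s0k] : fpath s0 l q && (s0 (last l q) == l).
  by move: cyc0; rewrite /= rcons_path.
have sfix0 i : i \notin l :: q -> s0 i = i.
  by move=> iq; rewrite s0E next_nth (negPf iq).
have mon0 : perm_mon k s0 = pmon (pv k l).
  by rewrite (path_verts_sym Tsym); apply: perm_mon_path up sq0 sfix0.
exists s0; split=> //; first by rewrite -{1}lq s0k.
  apply/forallP => i; apply/implyP => ik.
  have [iq|/sfix0 ->] := boolP (i \in l :: q); last by rewrite eqxx.
  suff /TG -> : T i (s0 i) by rewrite orbT.
  apply: (fpath_rel sq0 pq).
  by move: iq; rewrite lastI lq mem_rcons inE (negPf ik).
move=> s /eqP skl /forallP sG ss0; apply/lt_TGP; right; split.
  rewrite (wdeg_pmon Tsym Tirr Tacyc Gsym TG ckl) wdeg_perm_mon // -(sum_const_neq k).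
  by apply: eq_bigr => i ik; have := sG i; rewrite ik /= => ->.
have [/forallP sT|] := boolP [forall i, (i != k) ==> (i == s i) || T i (s i)]; last first.
  rewrite negb_forall => /existsP[i]; rewrite negb_imply => /andP[ik /negPf nT].
  left; rewrite (wdeg_pmon Tsym Tirr Tacyc Tsym (fun _ _ h => h) ckl) wdeg_perm_mon //.
  rewrite -(sum_const_neq k); apply: (ltn_sum_one ik); first by rewrite nT.
  by move=> j _; case: ifP.
right; split.
  rewrite (wdeg_pmon Tsym Tirr Tacyc Tsym (fun _ _ h => h) ckl) wdeg_perm_mon //.
  rewrite -(sum_const_neq k); apply: eq_bigr => i ik.
  by have := sT i; rewrite ik /= => ->.
have sT' i : i != k -> s i = i \/ T i (s i).
  by move=> ik; have := sT i; rewrite ik /= => /orP[/eqP e|]; [left|right].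
(* Uniqueness of paths in the forest forces s to agree with [s0] on the path. *)
have [q' [pq' uq' lq' sq']] := perm_cycle_path skl sT'.
have Eq : q' = q by apply: (upath_unique Tsym Tacyc _ up).
rewrite {}Eq {pq' uq' lq'} in sq'.
have sc i : i \in l :: q -> s i = s0 i.
  move=> iq; have cyc : fcycle s (l :: q) by rewrite /= rcons_path sq' lq /= skl eqxx.
  by rewrite s0E; have /eqP := next_cycle cyc iq.
have [i1 i1q si1] : exists2 i, i \notin l :: q & s i != i.
  have [i si] : exists i, s i != s0 i.
    apply/existsP; rewrite -negb_forall; apply: contra ss0 => /forallP E.
    by apply/eqP/permP => i; apply/eqP.
  have iq : i \notin l :: q by apply: contra si => /sc ->.
  by exists i; rewrite // -[X in _ != X](sfix0 i iq).
have i1k : i1 != k.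
  by apply: contraNneq i1q => ->; rewrite lastI lq mem_rcons mem_head.
rewrite -mon0 !wdeg_perm_mon //; apply: (ltn_sum_one i1k).
  by rewrite sfix0 // eqxx eq_sym (negPf si1).
move=> i ik; have [iq|iq] := boolP (i \in l :: q); first by rewrite sc.
by rewrite sfix0 // eqxx; case: ifP.
Qed.

Lemma cofactor_lead k l : connect T k l ->
  [/\ exists b : bool, (A k l)@_(pmon (pv k l)) = (-1) ^+ b
    & forall m, m \in msupp (A k l) -> m != pmon (pv k l) ->
        lt_TG T G m (pmon (pv k l)) /\ mdeg m = n.-1].
Proof.
case/perm_mon_lead=> s0 [s0k s0in s0E s0lt]; rewrite cofactorE; split.
  exists (odd_perm s0); rewrite raddf_sum (bigD1 s0) /=; last by rewrite s0k.
  rewrite mcoeffZ mcoeffX s0E eqxx mulr1 big1 ?addr0 // => s /andP[/andP[sk sin] ss0].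
  rewrite mcoeffZ mcoeffX; case: eqP => [E|]; last by rewrite mulr0.
  by have := s0lt s sk sin ss0; rewrite E lt_TG_irr.
move=> m /msupp_sum_le /flattenP[_ /mapP[s + ->]] /msuppZ_le.
rewrite mem_filter msuppX inE => /andP[/andP[sk sin] _] /eqP -> ms.
rewrite mdeg_perm_mon; split=> //; apply: s0lt => //.
by apply: contraNneq ms => ->; rewrite s0E.
Qed.

Lemma adjugate_relation k l :
  \sum_j X k j * A j l = (k == l)%:R * \det X.
Proof.
have /matrixP/(_ k l) := mul_mx_adj X; rewrite [RHS]mxE mulr_natl => <-.
rewrite [RHS]mxE; apply: eq_bigr => j _; rewrite [\adj _ _ _]mxE.
by rewrite cofactor_sym sparse_cofactor.unlock.
Qed.

End Cofactors.

(** * A basis of the ideal of minors with distinct leading monomials *)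

Section LeadingBasis.
Local Open Scope ring_scope.
Variables (K : fieldType) (n : nat) (G T : rel 'I_n) (i0 : 'I_n).
Hypothesis Gsym : ssrbool.symmetric G.
Hypothesis Tsym : ssrbool.symmetric T.
Hypothesis Tirr : irreflexive T.
Hypothesis Tacyc : forall c : seq 'I_n, (2 < size c)%N -> ~ ucycle T c.
Hypothesis TG : forall x y, T x y -> G x y.
Hypothesis TGconn : forall x y, connect T x y = connect G x y.
Implicit Types (i j k l : 'I_n) (u m t : 'X_{1..nvars n}).
Local Notation "'U2_ ( i , j )" := (U_(var_idx i j))%MM
  (at level 8, i, j at level 200, format "''U2_' ( i ,  j )").
Local Notation pv := (path_verts T).
Local Notation pmon := (pmon T).
Local Notation X := (X_of K G).
Local Notation A := (sparse_cofactor K G).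
Local Notation lt := (lt_TG T G).

Lemma connT_sym k l : connect T k l = connect T l k.
Proof. exact: sym_connect_sym. Qed.

Lemma pmon_diag k l i : pmon (pv k l) (var_idx i i) = (i \notin pv k l) :> nat.
Proof. by rewrite pmonE // eqxx. Qed.

Definition path_multiple u : bool :=
  [exists kl : 'I_n * 'I_n, connect T kl.1 kl.2 && (pmon (pv kl.1 kl.2) <= u)%MM].

(* A pair whose path cannot be shortened within [u]; [i0] breaks the tie
   between the principal minors. *)
Definition reduced u (kl : 'I_n * 'I_n) : bool :=
  [&& connect T kl.1 kl.2, (pmon (pv kl.1 kl.2) <= u)%MM &
    [&& kl.1 == i0, kl.2 == i0 & [forall i, u (var_idx i i) != 0%N]] ||
    (u (var_idx kl.1 kl.1) == 0%N) && (u (var_idx kl.2 kl.2) == 0%N)].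

(** An end whose diagonal variable divides u permits a shorter path. If k = l and this variable
    divides u, then all diagonal variables do, since the path monomial contains the others; the pair
    is then to be moved to [i0]. *)
Lemma reduced_cases u k l : connect T k l -> (pmon (pv k l) <= u)%MM ->
  [\/ reduced u (k, l), k != l /\ u (var_idx k k) != 0%N,
      k != l /\ u (var_idx l l) != 0%N
    | [/\ k = l, k != i0 & forall i, u (var_idx i i) != 0%N]].
Proof.
move=> ckl leu; rewrite /reduced /= ckl leu /=.
have [ekl|kl] := eqVneq k l; last first.
  case: (eqVneq (u (var_idx k k)) 0%N) => uk; last by apply: Or42.
  case: (eqVneq (u (var_idx l l)) 0%N) => ul; last by apply: Or43.
  by apply: Or41; rewrite orbT.
subst l; case: (eqVneq (u (var_idx k k)) 0%N) => uk.
  by apply: Or41; rewrite orbT.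
have ud i : u (var_idx i i) != 0%N.
  have [->//|ik] := eqVneq i k; rewrite -lt0n.
  apply: leq_trans (mnm_lepP leu (var_idx i i)).
  by rewrite pmon_diag (path_verts_refl Tsym Tacyc) inE ik.
have [ki|ki] := eqVneq k i0; last by apply: Or44.
by apply: Or41; apply/orP; left; apply/forallP.
Qed.

(** If the diagonal variable of h does not divide u, then h lies on every path whose monomial
    divides u. So the ends of each of two reduced pairs lie on the path of the other, unless both
    pairs are [(i0, i0)]. *)
Lemma reduced_uniq u kl kl' : reduced u kl -> reduced u kl' ->
  kl' = kl \/ kl' = (kl.2, kl.1).
Proof.
case: kl kl' => [k l] [k' l']; rewrite /reduced /=.
have inV i j h : (pmon (pv i j) <= u)%MM -> u (var_idx h h) == 0%N -> h \in pv i j.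
  move=> /mnm_lepP/(_ (var_idx h h)); rewrite pmon_diag => le /eqP u0.
  by move: le; rewrite u0 leqn0 eqb0 negbK.
move=> /and3P[c1 le1 /orP[/and3P[/eqP -> /eqP -> /forallP d1]|/andP[uk ul]]];
move=> /and3P[c2 le2 /orP[/and3P[/eqP -> /eqP -> /forallP d2]|/andP[uk' ul']]].
- by left.
- by case/negP: (d1 k').
- by case/negP: (d2 k).
have [kV lV] := (inV _ _ _ le2 uk, inV _ _ _ le2 ul).
have [kV' lV'] := (inV _ _ _ le1 uk', inV _ _ _ le1 ul').
case: (leqP #|pv k l| #|pv k' l'|) => [le|/ltnW le].
  by case: (path_verts_inj Tsym Tacyc c1 c2 kV' lV' le) => -[-> ->]; [left|right].
by case: (path_verts_inj Tsym Tacyc c2 c1 kV lV le) => -[-> ->]; [left|right].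
Qed.

Definition lead_multiple u (kl : 'I_n * 'I_n) : {mpoly K[nvars n]} :=
  let p := pmon (pv kl.1 kl.2) in
  ((A kl.1 kl.2)@_p)^-1 *: ('X_[u - p] * A kl.1 kl.2).

(** The value depends on u only: reduced pairs agree up to order, and the cofactors are symmetric.
    The default 0 is for u without a reduced pair. *)
Definition basis_elt u : {mpoly K[nvars n]} :=
  if [pick kl | reduced u kl] is Some kl then lead_multiple u kl else 0.

Lemma basis_eltE u kl : reduced u kl -> basis_elt u = lead_multiple u kl.
Proof.
move=> rkl; rewrite /basis_elt; case: pickP => [kl' rkl'|/(_ kl)]; last by rewrite rkl.
case: (reduced_uniq rkl rkl') => -> //.
by rewrite /lead_multiple /= (path_verts_sym Tsym) (cofactor_sym K Gsym).
Qed.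

Lemma cofactor_lead_neq0 k l : connect T k l -> (A k l)@_(pmon (pv k l)) != 0.
Proof.
move=> ckl; have [[b ->] _] := cofactor_lead K Gsym Tsym Tirr Tacyc TG ckl.
by rewrite signr_eq0.
Qed.

(** As k is on the path, its diagonal variable is not in the path monomial and must come from m. *)
Lemma diag_split k l u m : (m + pmon (pv k l) = u)%MM -> connect T k l ->
  u (var_idx k k) != 0%N -> exists m', m = (m' + 'U2_(k, k))%MM.
Proof.
move=> mE ckl uk; exists (m - 'U2_(k, k))%MM; rewrite submK // lep1mP.
by move: uk; rewrite -mE mnmDE pmon_diag (path_verts_ends Tsym Tacyc ckl).1 addn0.
Qed.

Lemma pmon_set1D k l : (pmon (pv k k) + 'U2_(k, k) = pmon (pv l l) + 'U2_(l, l))%MM.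
Proof.
have E h : (pmon (pv h h) + 'U2_(h, h) = \sum_i 'U2_(i, i))%MM.
  by rewrite (path_verts_refl Tsym Tacyc) pmon_set1 // [RHS](bigD1 h) //= addmC.
by rewrite !E.
Qed.

(** Shorten the path at an end whose diagonal variable divides u: by [pmon_first] the monomial of
    the shorter path still divides u. The number of vertices drops each time. *)
Lemma exists_reduced u : path_multiple u -> exists kl, reduced u kl.
Proof.
case/existsP=> -[k l] /= /andP[].
have [c] := ubnP #|pv k l|; elim: c k l => // c IH k l ltc ckl leu.
have step h j : (#|pv h j| <= c)%N -> connect T h j -> (pmon (pv h j) <= u)%MM ->
    h != j -> u (var_idx h h) != 0%N -> exists kl, reduced u kl.
  move=> lec chj leu' hj uh.
  have [i [Thi cij hV VE]] := path_verts_first Tsym Tacyc chj hj.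
  apply: (IH i j) => //; first by rewrite VE cardsU1 hV add1n in lec.
  have leU : (pmon (pv h j) + 'U2_(h, h) <= u)%MM.
    have [m' E] := diag_split (submK leu') chj uh.
    by rewrite -[X in (_ <= X)%MM](submK leu') E -addmA [('U2_(h, h) + _)%MM]addmC lem_addl.
  apply: lepm_trans leU; rewrite (pmon_first Tsym Tirr Tacyc Thi cij hV VE).
  exact: lem_addr.
case: (reduced_cases ckl leu) => [r|[kl uk]|[kl ul]|[_ _ ud]].
- by exists (k, l).
- exact: (step k l).
- by apply: (step l k); rewrite // 1?connT_sym // 1?(path_verts_sym Tsym) // eq_sym.
exists (i0, i0); rewrite /reduced /= connect0 eqxx /=; apply/andP; split.
  apply/mnm_lepP => v; rewrite [v]var_idx_surj pmonE // (path_verts_refl Tsym Tacyc) !inE.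
  case: eqP => [->|vv]; last first.
    case: and3P => // -[_ /eqP e1 /eqP e2]; case: vv; by rewrite e1 e2.
  by case: (_ != i0) => //=; rewrite lt0n.
by apply/orP; left; apply/forallP.
Qed.

Lemma cofactor_ideal k l : I_minors K G (A k l).
Proof.
wlog kl : k l / (k <= l)%N.
  by move=> H; case: (leqP k l) => [|/ltnW] /H //; rewrite (cofactor_sym K Gsym).
rewrite sparse_cofactor.unlock.
by apply: ideal_genM; apply: ideal_gen_sub; exists k, l.
Qed.

Lemma basis_elt_props u : path_multiple u ->
  [/\ I_minors K G (basis_elt u), (basis_elt u)@_u = 1
    & forall m, m \in msupp (basis_elt u) -> m != u -> lt m u /\ mdeg m = mdeg u].
Proof.
case/exists_reduced=> -[k l] r; rewrite (basis_eltE r) /lead_multiple /=.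
have /and3P[/= ckl leu _] := r; set p := pmon _; set c := (A k l)@_p.
have c0 : c != 0 by apply: cofactor_lead_neq0.
have mp : mdeg p = n.-1 by apply: mdeg_pmon.
have [_ low] := cofactor_lead K Gsym Tsym Tirr Tacyc TG ckl.
split.
- apply: ideal_genZ; apply: ideal_genM; exact: cofactor_ideal.
- have := mcoeffMX (A k l) (u - p)%MM p.
  by rewrite submK // mcoeffZ ['X_[_] * _]mulrC => ->; rewrite mulVf.
move=> m /msuppZ_le; rewrite mulrC (perm_mem (msuppMX _ _)) => /mapP[t tA ->] mu.
have tp : t != p by apply: contraNneq mu => ->; rewrite submK.
have [ltp mt] := low t tA tp; have E := submK leu; rewrite -/p in E.
split; last by rewrite mdegD mt -mp -mdegD E.
by rewrite -[X in lt _ X]E ![(u - p + _)%MM]addmC lt_TG_add2r.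
Qed.

Definition basis_span (f : {mpoly K[nvars n]}) : Prop :=
  exists2 s : seq (K * 'X_{1..nvars n}), (forall cu, cu \in s -> path_multiple cu.2)
    & f = \sum_(cu <- s) cu.1 *: basis_elt cu.2.

Lemma basis_span0 : basis_span 0.
Proof. by exists [::]; rewrite ?big_nil. Qed.

Lemma basis_spanD f g : basis_span f -> basis_span g -> basis_span (f + g).
Proof.
move=> [s sM ->] [t tM ->]; exists (s ++ t); last by rewrite big_cat.
by move=> cu; rewrite mem_cat => /orP[/sM|/tM].
Qed.

Lemma basis_spanZ c f : basis_span f -> basis_span (c *: f).
Proof.
move=> [s sM ->]; exists [seq (c * cu.1, cu.2) | cu <- s].
  by move=> _ /mapP[cu /sM ? ->].
by rewrite big_map scaler_sumr; apply: eq_bigr => cu _; rewrite scalerA.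
Qed.

Lemma basis_spanN f : basis_span f -> basis_span (- f).
Proof. by rewrite -scaleN1r; apply: basis_spanZ. Qed.

Lemma basis_span_sum (I : Type) (r : seq I) (P : pred I) (F : I -> {mpoly K[nvars n]}) :
  (forall x, P x -> basis_span (F x)) -> basis_span (\sum_(x <- r | P x) F x).
Proof.
by move=> PF; elim/big_ind: _ => //; [exact: basis_span0|exact: basis_spanD].
Qed.

Lemma basis_span_reduced m k l :
  reduced (m + pmon (pv k l))%MM (k, l) -> basis_span ('X_[m] * A k l).
Proof.
set u := (m + _)%MM => r; have /and3P[/= ckl leu _] := r.
exists [:: ((A k l)@_(pmon (pv k l)), u)].
  move=> cu; rewrite inE => /eqP ->; apply/existsP; exists (k, l).
  by rewrite /= ckl leu.
rewrite big_seq1 /= (basis_eltE r) /lead_multiple /= scalerA divff; last first.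
  exact: cofactor_lead_neq0.
by rewrite scale1r /u addmK.
Qed.

(** The off-diagonal part of row k is what replaces the diagonal term. Each of its terms has a
    leading monomial below u, or is the term of the path shortened at k, with leading monomial u. *)
Lemma basis_span_row m k l :
  let u := (m + (pmon (pv k l) + 'U2_(k, k)))%MM in connect T k l ->
  (forall m' i j, connect T i j -> lt (m' + pmon (pv i j))%MM u ->
     basis_span ('X_[m'] * A i j)) ->
  (forall m' j, connect T j l -> k \notin pv j l -> pv k l = k |: pv j l ->
     (m' + pmon (pv j l))%MM = u -> basis_span ('X_[m'] * A j l)) ->
  basis_span ('X_[m] * \sum_(j | j != k) X k j * A j l).
Proof.
move=> u ckl low top; rewrite mulr_sumr; apply: basis_span_sum => j jk.
rewrite X_ofE // eq_sym (negPf jk) /=; case: ifP => Gkj; last first.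
  by rewrite mul0r mulr0; apply: basis_span0.
have cjl : connect T j l.
  by apply: connect_trans ckl; rewrite TGconn connect1 // Gsym.
rewrite mulrA /x_ -mpolyXD.
have E : ((m + 'U2_(k, j)) + pmon (pv j l) = m + (pmon (pv j l) + 'U2_(k, j)))%MM.
  by rewrite -addmA [('U2_(k, j) + _)%MM]addmC.
have [ejk|[Tkj tu kV VE]|tlt] := relation_term_lt Gsym Tsym Tirr Tacyc TG ckl
    (introT orP (or_introl Gkj)) cjl.
- by rewrite ejk eqxx in jk.
- by apply: top => //; rewrite E tu.
- by apply: low => //; rewrite E /u ![(m + _)%MM]addmC lt_TG_add2r.
Qed.

Lemma X_of_diag k : X k k = 'X_(var_idx k k).
Proof. by rewrite X_ofE // eqxx. Qed.

Lemma relation_split k l : X k k * A k l =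
  (k == l)%:R * \det X - \sum_(j | j != k) X k j * A j l.
Proof. by rewrite -(adjugate_relation K Gsym) (bigD1 k) //= addrK. Qed.

(** Induction on the leading monomial u, then on the number of path vertices. If (k, l) is not
    reduced, a diagonal variable of an end is split off m and the adjugate relation yields smaller
    leading monomials or a shorter path. *)
Lemma basis_span_cofactor m k l : connect T k l -> basis_span ('X_[m] * A k l).
Proof.
move=> ckl; have [u mE] : exists u, (m + pmon (pv k l))%MM = u by eexists.
elim/(@lt_TG_ind n T G): u m k l ckl mE => u IHu m k l.
have [c] := ubnP #|pv k l|; elim: c m k l => // c IHc m k l ltc ckl mE.
have low m' i j : connect T i j -> lt (m' + pmon (pv i j))%MM u ->
    basis_span ('X_[m'] * A i j).
  by move=> cij ltu; apply: (IHu _ ltu).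
have shorten m' h j : (m' + pmon (pv h j))%MM = u -> (#|pv h j| < c.+1)%N ->
    connect T h j -> h != j -> u (var_idx h h) != 0%N ->
    basis_span ('X_[m'] * A h j).
  move=> m'E lec chj hj uh; have [m1 m1E] := diag_split m'E chj uh.
  have uE : u = (m1 + (pmon (pv h j) + 'U2_(h, h)))%MM.
    by rewrite -m'E m1E -addmA [('U2_(h, h) + _)%MM]addmC.
  rewrite m1E mpolyXD -mulrA -X_of_diag relation_split (negPf hj) mul0r sub0r mulrN.
  apply: basis_spanN; apply: basis_span_row => //; rewrite -uE //.
  move=> m2 i cij hV VE m2E; apply: IHc => //.
  by rewrite VE cardsU1 hV add1n ltnS in lec.
have leu : (pmon (pv k l) <= u)%MM by rewrite -mE lem_addl.
case: (reduced_cases ckl leu) => [r|[kl uk]|[kl ul]|[ekl ki ud]].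
- by apply: basis_span_reduced; rewrite mE.
- exact: shorten.
- rewrite (cofactor_sym K Gsym); apply: shorten => //.
  + by rewrite (path_verts_sym Tsym).
  + by rewrite (path_verts_sym Tsym).
  + by rewrite connT_sym.
  + by rewrite eq_sym.
(* For every h the path monomial of h times its diagonal variable is the full diagonal product, so
   all diagonal relations have the same leading monomial. *)
subst l; have [m1 m1E] := diag_split mE ckl (ud k).
have uE h : u = (m1 + (pmon (pv h h) + 'U2_(h, h)))%MM.
  by rewrite -(pmon_set1D k h) -mE m1E -addmA [('U2_(k, k) + _)%MM]addmC.
(* No term of equal leading monomial remains here, because h lies on every path ending in h. *)
have row h : basis_span ('X_[m1] * \sum_(j | j != h) X h j * A j h).
  apply: basis_span_row; rewrite ?connect0 // -uE // => m2 j cjh.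
  by rewrite (path_verts_ends Tsym Tacyc cjh).2.
rewrite m1E mpolyXD -mulrA -X_of_diag relation_split eqxx.
(* Expanding the determinant along row [i0] instead of row k transfers the leading term to the pair
   [(i0, i0)], which is reduced. *)
have -> : (true%:R * \det X : {mpoly K[nvars n]}) =
    X i0 i0 * A i0 i0 + \sum_(j | j != i0) X i0 j * A j i0.
  by rewrite relation_split eqxx subrK.
rewrite mulrBr mulrDr; apply: basis_spanD; last exact/basis_spanN/row.
apply: basis_spanD; last exact: row.
rewrite X_of_diag mulrA -mpolyXD; apply: basis_span_reduced.
have -> : (m1 + 'U2_(i0, i0) + pmon (pv i0 i0) = u)%MM.
  by rewrite -addmA [('U2_(i0, i0) + _)%MM]addmC -uE.
rewrite /reduced /= connect0 eqxx /= [X in _ && X](_ : _ = true) ?andbT.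
  by rewrite (uE i0) addmC -addmA lem_addr.
by apply/orP; left; apply/forallP.
Qed.

Lemma I_minors_span f : I_minors K G f -> basis_span f.
Proof.
case=> s sM ->; rewrite big_seq; apply: basis_span_sum => -[a g] /sM[k [l [_ /= ->]]].
have -> : \det (row' k (col' l X)) = (-1) ^+ (k + l) * A k l.
  by rewrite sparse_cofactor.unlock /cofactor mulrA -expr2 sqrr_sign mul1r.
rewrite mulrA; move: (a * _) => {}a; case: (boolP (connect T k l)) => ckl; last first.
  by rewrite (cofactor_eq0 K Gsym TGconn ckl) mulr0; apply: basis_span0.
rewrite [a]mpolyE mulr_suml; apply: basis_span_sum => m _.
by rewrite -scalerAl; apply: basis_spanZ; apply: basis_span_cofactor.
Qed.

End LeadingBasis.

(** * Initial ideal, radicality and height *)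

Section InitialForms.
Local Open Scope ring_scope.
Variables (K : fieldType) (N : nat) (lt : rel 'X_{1..N}).
Hypothesis lt_irr : irreflexive lt.
Hypothesis lt_trans : transitive lt.

Lemma init_form_unique (f : {mpoly K[N]}) p : f@_p != 0 ->
  (forall m, m \in msupp f -> m != p -> lt m p) -> init_form lt f = f@_p *: 'X_[p].
Proof.
move=> fp low; rewrite /init_form big_mkcond (bigD1_seq p) ?msupp_uniq ?mcoeff_msupp //=.
have -> : all (fun m => ~~ lt p m) (msupp f).
  apply/allP => m mf; have [->|/(low m mf) mp] := eqVneq m p; first by rewrite lt_irr.
  by apply/negP => /lt_trans /(_ mp); rewrite lt_irr.
rewrite big1_seq ?addr0 // => m /andP[mp mf]; case: allP => // /(_ p).
by rewrite mcoeff_msupp fp low // => /(_ isT).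
Qed.

End InitialForms.

HB.instance Definition _ (K : fieldType) (n : nat) (G : rel 'I_n) :=
  GRing.RMorphism.copy (@subst_Z K n G)
    (comp_mpoly [tuple (if in_Z G v then 0%R else 'X_v) | v < nvars n]).

Section Main.
Local Open Scope ring_scope.
Local Open Scope classical_set_scope.
Variables (K : fieldType) (n : nat) (G T : rel 'I_n).
Hypotheses (hn : (2 <= n)%N) (hG : simple_graph G) (hT : spanning_forest G T).
Implicit Types (i j k l : 'I_n) (u m t : 'X_{1..nvars n}).

Let i0 : 'I_n := Ordinal (ltnW hn).
Let Gsym : ssrbool.symmetric G := hG.1.
Let Tsym := spanning_forest_sym hT.
Let Tirr := spanning_forest_irr hG hT.
Let Tacyc := spanning_forest_acyclic hG hT.
Let TG : forall x y, T x y -> G x y := @spanning_forest_sub _ _ _ hT.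
Let TGconn := spanning_forest_connect hT.

Local Notation "'U2_ ( i , j )" := (U_(var_idx i j))%MM
  (at level 8, i, j at level 200, format "''U2_' ( i ,  j )").
Local Notation pv := (path_verts T).
Local Notation pmon := (pmon T).
Local Notation A := (sparse_cofactor K G).
Local Notation lt := (lt_TG T G).
Local Notation N := (nvars n).
Local Notation M := (path_multiple T).
Local Notation B := (basis_elt K G T i0).

Let B_ideal u : M u -> ideal_gen (minors K G) (B u).
Proof. by case/(basis_elt_props K i0 Gsym Tsym Tirr Tacyc TG). Qed.

Let B_lead u : M u -> (B u)@_u = 1.
Proof. by case/(basis_elt_props K i0 Gsym Tsym Tirr Tacyc TG). Qed.

Let B_low u m : M u -> m \in msupp (B u) -> m != u -> lt m u /\ mdeg m = mdeg u.
Proof. by case/(basis_elt_props K i0 Gsym Tsym Tirr Tacyc TG) => _ _; apply. Qed.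

Let B_span f : ideal_gen (minors K G) f -> exists2 s : seq (K * 'X_{1..N}),
  (forall cu, cu \in s -> M cu.2) & f = \sum_(cu <- s) cu.1 *: B cu.2.
Proof. exact: (@I_minors_span K n G T i0 Gsym Tsym Tirr Tacyc TG TGconn). Qed.

Let lt_irr : irreflexive lt := @lt_TG_irr n T G.
Let lt_trans : transitive lt := @lt_TG_trans n T G.
Let lt_weak a b c : lt a c -> lt a b || lt b c := @lt_TG_weak n T G a b c.
Let lt_add2r a b c : lt (a + c)%MM (b + c)%MM = lt a b := lt_TG_add2r T G a b c.
Let lt_wf := @lt_TG_ind n T G.

Let I_top f m : I_minors K G f -> m \in msupp f ->
  (forall m', m' \in msupp f -> ~~ lt m m') -> M m.
Proof. exact: (top_monomial lt_irr lt_trans lt_weak B_lead B_low B_span). Qed.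

Let I_normal f : exists g, ideal_gen (minors K G) (f - g) /\
  forall m, m \in msupp g -> ~~ M m /\ (mdeg m < msize f)%N.
Proof. exact: (normal_form lt_wf B_ideal B_lead B_low). Qed.

Lemma pmon_le1 V v : (pmon V v <= 1)%N.
Proof. by rewrite mnmE leq_b1. Qed.

Lemma path_multipleP u :
  reflect (exists k l, connect T k l /\ (pmon (pv k l) <= u)%MM) (M u).
Proof.
apply: (iffP existsP) => [[[k l] /= /andP[ckl le]]|[k [l [ckl le]]]].
  by exists k, l.
by exists (k, l); rewrite /= ckl.
Qed.

(** Intermediate between the initial ideal and [I_T_Z0]: trivial paths are included, and no variable
    of Z occurs. *)
Definition path_ideal : set {mpoly K[N]} :=
  ideal_gen [set 'X_[m] | m in [set m | exists k l, connect T k l /\ m = pmon (pv k l)]].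

Lemma path_ideal_gen k l : connect T k l -> path_ideal 'X_[pmon (pv k l)].
Proof. by move=> ckl; apply: ideal_gen_sub; exists (pmon (pv k l)) => //; exists k, l. Qed.

Lemma path_ideal_mon u : M u -> path_ideal 'X_[u].
Proof.
case/path_multipleP=> k [l [ckl le]]; rewrite -(submK le) mpolyXD.
exact/ideal_genM/path_ideal_gen.
Qed.

(** The sign covers both the cofactors themselves and the minors. *)
Lemma init_cofactor k l (c : {mpoly K[N]}) b : connect T k l -> c = (-1) ^+ b * A k l ->
  c != 0 /\ exists2 a : K, a != 0 & init_form lt c = a *: 'X_[pmon (pv k l)].
Proof.
move=> ckl cE; have [[b' lead] low] := cofactor_lead K Gsym Tsym Tirr Tacyc TG ckl.
have {}cE : c = ((-1) ^+ b : K) *: A k l.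
  by rewrite cE -mul_mpolyC rmorphXn rmorphN rmorph1.
set p := pmon _ in lead low *.
have cp : c@_p != 0 by rewrite cE mcoeffZ lead mulf_neq0 // signr_eq0.
split; first by apply: contraNneq cp => ->; rewrite mcoeff0.
exists c@_p => //; apply: init_form_unique => // m mc mp.
by have [] := low m (msuppZ_le (c := (-1) ^+ b) _) mp; rewrite -?cE.
Qed.

Lemma minorE k l :
  \det (row' k (col' l (X_of K G))) = (-1) ^+ (k + l) * A k l.
Proof. by rewrite sparse_cofactor.unlock /cofactor mulrA -expr2 sqrr_sign mul1r. Qed.

Lemma init_ideal_path : init_ideal lt (I_minors K G) = path_ideal.
Proof.
apply/seteqP; split.
  apply: ideal_gen_min => _ [f [If f0 ->]]; rewrite /init_form.
  apply: ideal_gen_sum => m mf /allP mmax; apply: ideal_genZ.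
  by apply: path_ideal_mon; apply: (I_top If).
apply: ideal_gen_min => _ [_ [k [l [ckl ->]]] <-].
have [c0 [a a0 E]] := init_cofactor (b := 0) ckl (esym (mul1r _)).
rewrite -[X in ideal_gen _ X](scalerK a0) -E; apply: ideal_genZ; apply: ideal_gen_sub.
by exists (A k l); split=> //; apply: cofactor_ideal.
Qed.

Lemma minors_groebner : groebner_basis lt (minors K G) (I_minors K G).
Proof.
have sub : minors K G `<=` I_minors K G by move=> f; apply: ideal_gen_sub.
split=> //; apply/seteqP; split.
  by apply: ideal_gen_min => _ [f [Sf f0 ->]]; apply: ideal_gen_sub; exists f; split=> //; apply: sub.
rewrite init_ideal_path; apply: ideal_gen_min => _ [_ [k [l [ckl ->]]] <-].
wlog kl : k l ckl / (k <= l)%N.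
  move=> H; case: (leqP k l) => [|/ltnW lk]; first exact: H.
  by rewrite (path_verts_sym Tsym); apply: H lk; rewrite (sym_connect_sym Tsym).
have [c0 [a a0 E]] := init_cofactor ckl (minorE k l).
rewrite -[X in ideal_gen _ X](scalerK a0) -E; apply: ideal_genZ; apply: ideal_gen_sub.
by exists (\det (row' k (col' l (X_of K G)))); split=> //; exists k, l.
Qed.

Lemma subst_Z_diag (P : pred 'I_n) :
  subst_Z G (\prod_(j | P j) x_ K j j) = \prod_(j | P j) x_ K j j.
Proof.
rewrite rmorph_prod; apply: eq_bigr => j _.
by rewrite /= (subst_Z_var K Gsym) eqxx.
Qed.

Lemma subst_Z_path k p : path T k p ->
  subst_Z G (path_monomial K k p) = path_monomial K k p.
Proof.
rewrite path_zip => /allP pT; rewrite /path_monomial rmorph_prod.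
apply: eq_big_seq => e /pT /TG Ge.
by rewrite /= (subst_Z_var K Gsym) Ge orbT.
Qed.

Lemma path_generator k p l : upath T k p l ->
  (\prod_(i | i \notin k :: p) x_ K i i) * path_monomial K k p = 'X_[pmon (pv k l)].
Proof.
move=> up; rewrite (pmon_path Tsym Tirr Tacyc up) mpolyXD /path_monomial.
by rewrite /x_ -!mprodXE.
Qed.

(** Trivial paths give the diagonal generators. A generator for k, l without a path in [T] contains
    a variable of Z, as an edge kl of [G] would connect them, so it becomes 0. The other generators
    are unchanged. *)
Lemma path_ideal_Z0 : path_ideal = I_T_Z0 K G T.
Proof.
apply/seteqP; split.
  apply: ideal_gen_min => _ [_ [k [l [ckl ->]]] <-]; have [p up] := connect_upath ckl.
  have [pT uk lk] := up; apply: ideal_gen_sub; rewrite -(path_generator up).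
  exists ((\prod_(i | i \notin k :: p) x_ K i i) * path_monomial K k p).
    apply: ideal_gen_sub; case: p up pT uk lk => [|j p] up pT uk lk.
      rewrite /path_monomial big_nil mulr1.
      rewrite (eq_bigl (fun j => j != k)) => [|j]; last by rewrite inE.
      exact: I_T_diag.
    by apply: I_T_path; rewrite /simple_path pT uk.
  by rewrite rmorphM /= subst_Z_diag subst_Z_path.
apply: ideal_gen_min => _ [_ [s sT ->] <-]; rewrite rmorph_sum.
apply: ideal_gen_sum => -[a g] /sT /= gT _; rewrite rmorphM /=; apply: ideal_genM.
case: gT => [i|k l kl nopath|k p /and3P[_ pT up]].
- have up : upath T i [::] i by [].
  have := path_generator up; rewrite /path_monomial big_nil mulr1 subst_Z_diag.
  rewrite (eq_bigl (fun j => j != i)) => [->|j]; last by rewrite inE.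
  exact: path_ideal_gen.
- rewrite rmorphM /= (subst_Z_var K Gsym k l); case: ifP => [|_]; last first.
    by rewrite mulr0; apply: ideal_gen0.
  rewrite -val_eqE /= (ltn_eqF kl) /= => Gkl; case: nopath.
  have /connect_upath[p up] : connect T k l by rewrite TGconn connect1.
  have [pT uk lk] := up; exists p; split=> //; rewrite /simple_path pT uk !andbT.
  by apply: contraTneq kl => p0; rewrite -lk p0 /= ltnn.
have up' : upath T k p (last k p) by [].
rewrite rmorphM /= subst_Z_diag subst_Z_path // (path_generator up').
exact/path_ideal_gen/(upath_connect up').
Qed.

Lemma init_ideal_squarefree :
  squarefree_monomial_ideal (init_ideal lt (I_minors K G)).
Proof.
exists [set m | exists k l, connect T k l /\ m = pmon (pv k l)]; last exact: init_ideal_path.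
by move=> _ [k [l [_ ->]]] v; apply: pmon_le1.
Qed.

(** The exponents of a path monomial are at most 1, so if it divides a power of a monomial it
    divides the monomial. *)
Lemma I_minors_radical : radical_ideal (I_minors K G).
Proof.
apply: (squarefree_radical lt_irr lt_trans lt_weak lt_add2r lt_wf B_ideal B_lead B_low B_span).
move=> m e /path_multipleP[k [l [ckl /mnm_lepP le]]]; apply/path_multipleP.
exists k, l; split=> //; apply/mnm_lepP => v; have := le v; rewrite mulmnE.
by case: (m v) => [|d] // _; apply: leq_trans (pmon_le1 _ _) _.
Qed.

Let h : nat := (if connected_graph G then 3 else 2)%N.

Lemma path_verts_connect k l v : v \in pv k l -> connect T k v.
Proof.
rewrite path_verts.unlock inE => /asboolP[p [pT _ _] vp].
by case/splitPl: vp pT => p1 p2 <-; rewrite cat_path => /andP[p1T _]; apply/connectP; exists p1.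
Qed.

(** A path monomial missing the diagonal variables of a and b comes from a path through both. If ab
    is an edge of [T], it contains that edge; if a and b lie in different components, there is no
    such path. *)
Lemma hitting_set : exists Hs : {set 'I_N}, #|Hs| = h /\
  forall u, M u -> exists2 v, v \in Hs & u v != 0%N.
Proof.
have hit (Hs : {set 'I_N}) : (forall k l, connect T k l ->
    exists2 v, v \in Hs & pmon (pv k l) v != 0%N) ->
    forall u, M u -> exists2 v, v \in Hs & u v != 0%N.
  move=> H u /path_multipleP[k [l [/H[v vH nz] /mnm_lepP/(_ v) le]]].
  by exists v => //; rewrite -lt0n (leq_trans _ le) // lt0n.
have diag k l i : i \notin pv k l -> pmon (pv k l) (var_idx i i) != 0%N.
  by rewrite pmon_diag // => ->.
rewrite /h; case: ifP => [/forallP conn|/negbT].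
  (* Since n is at least 2, the vertices 0 and 1 exist, and the path between them starts with an
     edge of [T]. *)
  have ci1 : connect T i0 (Ordinal hn) by rewrite TGconn (forallP (conn _)).
  have [j [Tj _ _ _]] := path_verts_first Tsym Tacyc ci1 isT.
  have ij : i0 != j by apply: contraTneq Tj => <-; rewrite Tirr.
  exists [set var_idx i0 i0; var_idx j j; var_idx i0 j]%SET; split.
    rewrite -finset.setUA cardsU1 cards2 !inE !var_idx_eq !eqxx (negPf ij) [j == i0]eq_sym (negPf ij).
    by [].
  apply: hit => k l ckl; case: (boolP (i0 \in pv k l)) => iV; last first.
    by exists (var_idx i0 i0); [rewrite !inE eqxx|exact: diag].
  case: (boolP (j \in pv k l)) => jV; last first.
    by exists (var_idx j j); [rewrite !inE eqxx !orbT|exact: diag].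
  exists (var_idx i0 j); first by rewrite !inE eqxx !orbT.
  by rewrite pmonE // (negPf ij) Tj iV jV.
rewrite negb_forall => /existsP[a]; rewrite negb_forall => /existsP[b nab].
have ab : a != b by apply: contraNneq nab => ->; rewrite connect0.
exists [set var_idx a a; var_idx b b]%SET; split.
  by rewrite cards2 var_idx_eq (negPf ab).
apply: hit => k l ckl; case: (boolP (a \in pv k l)) => aV; last first.
  by exists (var_idx a a); [rewrite !inE eqxx|exact: diag].
exists (var_idx b b); first by rewrite !inE eqxx orbT.
apply: diag; apply: contra nab => bV; rewrite -TGconn.
apply: connect_trans (path_verts_connect bV).
by rewrite (sym_connect_sym Tsym) (path_verts_connect aV).
Qed.

(** With fewer than [h] vanishing exponents, some path monomial avoids all of the vanishing
    variables and so divides m. *)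
Lemma standard_zeros m : ~~ M m -> (h <= #|[set v | m v == 0%N]%SET|)%N.
Proof.
apply: contraNT; rewrite -ltnNge; set Z := [set v | _]%SET => ltZ.
apply/path_multipleP.
suff [k [l [ckl klZ]]] : exists k l, connect T k l /\ forall v, v \in Z -> pmon (pv k l) v = 0%N.
  exists k, l; split=> //; apply/mnm_lepP => v; case: (boolP (v \in Z)) => [/klZ ->//|].
  by rewrite inE -lt0n; apply: leq_trans (pmon_le1 _ _).
pose D := [set i | var_idx i i \in Z]%SET.
have var_inj : injective (fun i => var_idx i i).
  by move=> i j /eqP; rewrite var_idx_eq orbb andbb => /eqP.
have DZ : [set var_idx i i | i in D]%SET \subset Z.
  by apply/fintype.subsetP => _ /imsetP[i iD ->]; rewrite inE in iD.
have cD : #|[set var_idx i i | i in D]%SET| = #|D| by rewrite card_imset.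
(* If at most one diagonal variable vanishes, the trivial path at that vertex serves, or at any
   vertex if none vanishes. *)
have [D1|] := leqP #|D| 1.
  have [a Da] : exists a, forall i, i \in D -> i = a.
    have [D0|[a aD]] := set_0Vmem D; first by exists i0 => i; rewrite D0 inE.
    exists a => i iD; apply/eqP; apply: contraTT D1 => ia; rewrite -ltnNge.
    have iDa : i \in (D :\ a)%SET by rewrite in_setD1 ia iD.
    by rewrite (cardsD1 a) aD (cardsD1 i (D :\ a)%SET) iDa.
  exists a, a; split=> [|v vZ]; first exact: connect0.
  have := vZ; rewrite {1}[v]var_idx_surj [v in pmon _ v]var_idx_surj.
  move: (var_fst v) (var_snd v) => i j ijZ.
  rewrite pmonE // (path_verts_refl Tsym Tacyc) !inE; case: eqP => [ij|ij].
    by rewrite (Da i) ?eqxx //; rewrite inE {2}ij.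
  by case: and3P => // -[_ /eqP e1 /eqP e2]; case: ij; rewrite e1 e2.
(* With two vanishing diagonal variables, [h] must be 3 and nothing else vanishes; the path joining
   the two vertices avoids both variables. *)
move=> D2; have leDZ := subset_leq_card DZ; rewrite cD in leDZ.
move: ltZ; rewrite /h; case: ifP => [/forallP conn ltZ|_ ltZ]; last first.
  by have := leq_trans D2 (leq_trans leDZ ltZ).
have D2' : #|D| == 2 by rewrite eqn_leq D2 andbT (leq_trans leDZ).
have ZE : [set var_idx i i | i in D]%SET = Z.
  by apply/eqP; rewrite eqEcard DZ cD (eqP D2') -ltnS.
have /cards2P[a [b [_ DE]]] := D2'.
have cab : connect T a b by rewrite TGconn (forallP (conn a)).
exists a, b; split=> // v; rewrite -ZE => /imsetP[i + ->]; rewrite DE !inE pmon_diag //.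
by have [aV bV] := path_verts_ends Tsym Tacyc cab; case/orP=> /eqP ->; rewrite ?aV ?bV.
Qed.

Lemma I_minors_height : ideal_height (I_minors K G) h.
Proof.
have [Hs [cH hitH]] := hitting_set.
have hN : (h <= N)%N by rewrite -cH -[X in (_ <= X)%N]card_ord max_card.
have lower P : prime_ideal P -> I_minors K G `<=` P -> prime_chain_to P h.
  move=> Pp IP; apply: codim_le_height => // Y indY.
  apply: (indep_vars_standard_bound (S := minors K G) (M := M) _ I_normal) => [f fY If|m Mm].
    by apply: indY fY (IP _ If).
  (* At least [h] exponents vanish, so a standard monomial involves at most N - h variables. *)
  have := cardsC [set v | m v == 0%N]%SET; rewrite card_ord => E.
  have -> : [set v | m v != 0%N]%SET = (~: [set v | m v == 0%N])%SET.
    by apply/setP => v; rewrite !inE.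
  by rewrite leq_subRL // -[X in (_ <= X)%N]E leq_add2r standard_zeros.
split; last exact: lower.
pose Y := (~: Hs)%SET.
have cY : (#|Y| + h = N)%N by rewrite -cH addnC cardsC card_ord.
(* A prime containing the minors but no nonzero polynomial in the variables off the hitting set
   keeps N - h variables independent, which bounds its height by [h]. *)
have [||f If [f0 fY]|P [Pp SP PT]] := @prime_avoiding _ (minors K G)
  [set f : {mpoly K[N]} | f != 0 /\ supported Y f].
- split; first exact: oner_neq0.
  by move=> m; rewrite msupp1 inE => /eqP -> v _; rewrite mnm0E.
- move=> f g [f0 fY] [g0 gY]; split; first exact: mulf_neq0.
  move=> m /msuppM_le /allpairsP[[a b] /= [af bg ->]] v vY.
  by rewrite mnmDE (fY a af v vY) (gY b bg v vY).
(* A maximal monomial of f is a path multiple, so it involves a variable of [Hs], which the support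
   of f excludes. *)
- have [|m mf mmax] := weak_order_max lt_irr lt_trans (U := msupp f); first by rewrite msupp_eq0.
  have [v vH /negP[]] := hitH m (I_top If mf mmax).
  by rewrite (fY m mf v) // inE negbK.
have IP : I_minors K G `<=` P.
  move=> _ [s sS ->]; rewrite big_seq; apply: prime_ideal_sum => // ab /sS /SP.
  exact: prime_idealM.
exists P; split=> //; split; first exact: lower.
move=> m ch; rewrite -(leq_add2l #|Y|) cY; apply: height_le_codim ch _.
move=> f fY Pf; apply/eqP; apply: contrapT => /negP f0.
by apply: (PT f Pf).
Qed.

End Main.

Theorem corollary7 (K : fieldType) (n : nat) (G T : rel 'I_n)
    (hn : (2 <= n)%N) (hG : simple_graph G) (hT : spanning_forest G T) :
  [/\ groebner_basis (lt_TG T G) (minors K G) (I_minors K G),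
      init_ideal (lt_TG T G) (I_minors K G) = I_T_Z0 K G T,
      squarefree_monomial_ideal (init_ideal (lt_TG T G) (I_minors K G)),
      radical_ideal (I_minors K G)
    & ideal_height (I_minors K G) (if connected_graph G then 3 else 2)].
Proof.
split.
- exact: minors_groebner.
- by rewrite init_ideal_path //; apply: path_ideal_Z0.
- exact: init_ideal_squarefree.
- exact: I_minors_radical hT.
- exact: I_minors_height hT.
Qed.
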